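(* Let $F:M^n\to\mathcal{L}^{2n-1,1}$ be a flat immersion with flat, non-degenerate normal bundle and curvature normals $v_1,\dots,v_n$. Then there exist curvature line co-ordinates $x_1,\dots,x_n$ on $M$. Moreover $F$ and its first fundamental form $\mathrm{I}_F$ can be written entirely in terms of the curvature normals as $$F=-\sum_{j=1}^n\frac{v_j}{(v_j,v_j)},\qquad \mathrm{I}_F=\sum_{i=1}^n\frac{dx_i^2}{|(v_i,v_i)|}.$$
   Context: $\mathbb{R}^{2n-1,1}$ is $\mathbb{R}^{2n}$ with the Lorentzian bilinear form $(x,y)=x^T\operatorname{diag}(1,\dots,1,-1)\,y$, and $\mathcal{L}^{2n-1,1}=\{x:(x,x)=0\}$ is its light-cone. $F$ flat means that its induced metric $\mathrm{I}_F=(dF,dF)$ is positive definite and flat. The normal bundle $N_F$ is the orthogonal complement of the tangent bundle in $M\times\mathbb{R}^{2n-1,1}$ (rank $n$, signature $(n-1,1)$); it is flat if the normal connection is flat. For a normal vector $v$ the shape operator $A_v$ is the tangential part of $-dv$. The normal bundle is non-degenerate if at each point the dimension of the space of shape operators equals the codimension $n$. With flat normal bundle, the tangent spaces decompose orthogonally into the common eigenspaces $E_i$ of all shape operators (curvature distributions), and the curvature normals $v_i\in N_F$ are defined by $A_v|_{E_i}=(v,v_i)\operatorname{Id}$ for all normal $v$. For flat non-degenerate normal bundle there are $n$ curvature distributions, each of rank one. Curvature line co-ordinates are co-ordinates for which each $\partial/\partial x_i$ spans $E_i$. *)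

(* Defs.v *)
From HB Require Import structures.
From mathcomp Require Import all_boot all_order all_algebra.
From mathcomp Require Import all_classical all_reals all_analysis.
Set Implicit Arguments.
Unset Strict Implicit.
Unset Printing Implicit Defensive.
Import Order.TTheory GRing.Theory Num.Theory.
Import numFieldNormedType.Exports.
Local Open Scope classical_set_scope.
Local Open Scope ring_scope.

(* Tangent vectors of a chart domain are row vectors X, so that the differential
   of f at a is X |-> X *m 'J f a and row i of 'J f a is the i-th partial
   derivative of f. An endomorphism A of the tangent space acts by X *m A. *)

Section Smoothness.
Context {R : realType} {m n : nat}.

(* Only meaningful for open U. *)
Fixpoint Ck_on (k : nat) (U : set 'rV[R]_m) (f : 'rV[R]_m -> 'rV[R]_n) : Prop :=
  if k is k'.+1 then
    (forall a, U a -> differentiable f a) /\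
    (forall X, Ck_on k' U (fun a => 'D_X f a))
  else forall a, U a -> {for a, continuous f}.

Definition smooth_on (U : set 'rV[R]_m) (f : 'rV[R]_m -> 'rV[R]_n) : Prop :=
  forall k, Ck_on k U f.

Definition smooth_near (a : 'rV[R]_m) (f : 'rV[R]_m -> 'rV[R]_n) : Prop :=
  exists U, [/\ open U, U a & smooth_on U f].

End Smoothness.

Section Manifolds.
Context {R : realType}.

(* chart_map and chart_inv are total functions; their values outside chart_dom,
   resp. outside chart_map @` chart_dom, are irrelevant. *)
Record chart (n : nat) (M : topologicalType) := Chart {
  chart_dom : set M;
  chart_map : M -> 'rV[R]_n;
  chart_inv : 'rV[R]_n -> M;
  chart_dom_open : open chart_dom;
  chart_image_open : open (chart_map @` chart_dom);
  chart_mapK : {in chart_dom, cancel chart_map chart_inv};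
  chart_map_continuous : forall p, chart_dom p -> {for p, continuous chart_map};
  chart_inv_continuous :
    forall a, (chart_map @` chart_dom) a -> {for a, continuous chart_inv}
}.

Definition smooth_transition n M (c d : chart n M) : Prop :=
  smooth_on (chart_map c @` (chart_dom c `&` chart_dom d))
            (chart_map d \o chart_inv c).

Definition compatible n M (c d : chart n M) : Prop :=
  smooth_transition c d /\ smooth_transition d c.

Record smooth_manifold (n : nat) (M : topologicalType) := SmoothManifold {
  atlas : set (chart n M);
  atlas_cover : forall p, exists2 c, atlas c & chart_dom c p;
  atlas_compatible : forall c d, atlas c -> atlas d -> compatible c d;
  manifold_hausdorff : hausdorff_space M;
  manifold_second_countable : @second_countable M
}.

Definition max_atlas n M (S : smooth_manifold n M) : set (chart n M) :=
  [set c | forall d, atlas S d -> compatible c d].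

Definition smooth_map n N M (S : smooth_manifold n M) (F : M -> 'rV[R]_N) :=
  forall c, atlas S c ->
    smooth_on (chart_map c @` chart_dom c) (F \o chart_inv c).

(* P holds at every point for the local expression of F in every chart. *)
Definition in_charts n N M (S : smooth_manifold n M) (F : M -> 'rV[R]_N)
    (P : ('rV[R]_n -> 'rV[R]_N) -> 'rV[R]_n -> Prop) : Prop :=
  forall c, atlas S c -> forall p, chart_dom c p ->
    P (F \o chart_inv c) (chart_map c p).

Definition immersion n N M (S : smooth_manifold n M) (F : M -> 'rV[R]_N) :=
  smooth_map S F /\ in_charts S F (fun f a => row_free ('J f a)).

End Manifolds.

Section LorentzForm.
Context {R : realType} {N : nat}.

Definition lorentz_mx : 'M[R]_N :=
  diag_mx (\row_i if i.+1 == N then -1 else 1).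

Definition lform (x y : 'rV[R]_N) : R := (x *m lorentz_mx *m y^T) 0 0.

Definition light_cone : set 'rV[R]_N := [set x | lform x x = 0].

End LorentzForm.

Section Curvature.
Context {R : realType} {n : nat} (g : 'rV[R]_n -> 'M[R]_n).

Definition basis_vec (i : 'I_n) : 'rV[R]_n := delta_mx 0 i.

(* The coefficient of d_k in nabla_{d_i} d_j. *)
Definition christoffel (i j k : 'I_n) (a : 'rV[R]_n) : R :=
  2^-1 * \sum_l invmx (g a) k l *
    ('D_(basis_vec i) (fun b => g b j l) a
     + 'D_(basis_vec j) (fun b => g b i l) a
     - 'D_(basis_vec l) (fun b => g b i j) a).

(* The coefficient of d_l in R(d_i, d_j) d_k. *)
Definition riemann (i j k l : 'I_n) (a : 'rV[R]_n) : R :=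
  'D_(basis_vec i) (christoffel j k l) a
  - 'D_(basis_vec j) (christoffel i k l) a
  + \sum_m (christoffel j k m a * christoffel i m l a
            - christoffel i k m a * christoffel j m l a).

End Curvature.

(* f is the local expression of an immersion. Everything below depends only on
   the germ of f at a. *)
Section LocalGeometry.
Context {R : realType} {n N : nat} (f : 'rV[R]_n -> 'rV[R]_N).

Definition first_form (a : 'rV[R]_n) : 'M[R]_n :=
  \matrix_(i, j) lform ('D_(basis_vec i) f a) ('D_(basis_vec j) f a).

Definition pos_def_at (a : 'rV[R]_n) : Prop :=
  forall X : 'rV[R]_n, X != 0 -> 0 < (X *m first_form a *m X^T) 0 0.

Definition flat_at (a : 'rV[R]_n) : Prop :=
  pos_def_at a /\ forall i j k l, riemann first_form i j k l a = 0.

Definition normal_at (a : 'rV[R]_n) (w : 'rV[R]_N) : Prop :=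
  forall X : 'rV[R]_n, lform ('D_X f a) w = 0.

(* w *m tan_mx a is the tangent vector X such that w - X *m 'J f a is normal. *)
Definition tan_mx (a : 'rV[R]_n) : 'M[R]_(N, n) :=
  lorentz_mx *m ('J f a)^T *m invmx (first_form a).

Definition normal_part (a : 'rV[R]_n) (w : 'rV[R]_N) : 'rV[R]_N :=
  w - w *m tan_mx a *m 'J f a.

Definition normal_field_near (a : 'rV[R]_n) (xi : 'rV[R]_n -> 'rV[R]_N) : Prop :=
  smooth_near a xi /\ \forall b \near a, normal_at b (xi b).

Definition normal_connection (X : 'rV[R]_n) (xi : 'rV[R]_n -> 'rV[R]_N)
    (a : 'rV[R]_n) : 'rV[R]_N :=
  normal_part a ('D_X xi a).

(* The curvature of the normal connection vanishes; X and Y are constant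
   coordinate fields, so there is no Lie bracket term. *)
Definition normal_flat_at (a : 'rV[R]_n) : Prop :=
  forall xi, normal_field_near a xi -> forall X Y : 'rV[R]_n,
    normal_connection X (normal_connection Y xi) a
    = normal_connection Y (normal_connection X xi) a.

(* The operator A_v for v = xi a: the tangential part of - d xi. *)
Definition shape_op (xi : 'rV[R]_n -> 'rV[R]_N) (a : 'rV[R]_n) : 'M[R]_n :=
  - ('J xi a *m tan_mx a).

Definition shape_ops (a : 'rV[R]_n) : set 'M[R]_n :=
  [set shape_op xi a | xi in normal_field_near a].

Definition nondegenerate_at (a : 'rV[R]_n) : Prop :=
  exists2 V : {vspace 'M[R]_n}, \dim V = (N - n)%N & shape_ops a = [set` V].

(* The common eigenspace with eigenvalues v |-> lform v w. *)
Definition curvature_dist (a : 'rV[R]_n) (w : 'rV[R]_N) : set 'rV[R]_n :=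
  [set X | forall xi, normal_field_near a xi ->
             X *m shape_op xi a = lform (xi a) w *: X].

Definition curvature_normal (a : 'rV[R]_n) (w : 'rV[R]_N) : Prop :=
  normal_at a w /\ exists2 X, X != 0 & curvature_dist a w X.

End LocalGeometry.

(* v_1, ..., v_k are smooth sections of the normal bundle which at each point
   list the curvature normals without repetition. *)
Definition curvature_normals (R : realType) n N k (M : topologicalType)
    (S : smooth_manifold n M) (F : M -> 'rV[R]_N) (v : 'I_k -> M -> 'rV[R]_N) :=
  [/\ forall i, smooth_map S (v i),
      forall p, injective (v ^~ p)
    & forall c, atlas S c -> forall p, chart_dom c p -> forall w,
        curvature_normal (F \o chart_inv c) (chart_map c p) w <->
        exists i, w = v i p].

(* The coordinate field d/dx_i of the chart c spans the curvature distribution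
   with curvature normal v_i. *)
Definition curvature_line_coords (R : realType) n N (M : topologicalType)
    (F : M -> 'rV[R]_N) (v : 'I_n -> M -> 'rV[R]_N) (c : chart n M) : Prop :=
  forall q, chart_dom c q -> forall i,
    curvature_dist (F \o chart_inv c) (chart_map c q) (v i q)
    = [set t *: basis_vec i | t in [set: R]].

(* Main.v *)
Require Import Defs.
From HB Require Import structures.
From mathcomp Require Import all_boot all_order all_algebra.
From mathcomp Require Import all_classical all_reals all_analysis.
From mathcomp Require Import ring lra.
Set Implicit Arguments.
Unset Strict Implicit.
Unset Printing Implicit Defensive.
Import Order.TTheory GRing.Theory Num.Theory.
Import numFieldNormedType.Exports.
Local Open Scope classical_set_scope.
Local Open Scope ring_scope.

(* The position vector F is itself a normal field, with shape operator -Id, so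
   (F, v_i) = -1. The Gauss equation of a flat metric, applied to eigenvectors
   X_i, X_j, gives (v_i, v_j) = 0 for i <> j. By nondegeneracy a normal vector
   orthogonal to all v_i vanishes, whence (v_i, v_i) <> 0 and the formula for F.

   For the coordinates, let eps_j be a smooth unit tangent field spanning E_j, let
   h_j = sqrt |(v_j, v_j)| and u_j = v_j / h_j, so that (u_j, u_j) is a constant
   sign s_j. The 1-form theta_j = h_j (eps_j, dF) = - s_j (du_j, eps_j) is closed,
   because (D_Y u_j, D_X eps_j) = 0 for all X and Y: expanded in the frame
   (eps_k, v_k), each term has a vanishing factor. Hence theta_j = d x_j locally,
   and the x_j form a chart by the inverse function theorem; in it the k-th
   partial derivative of F is eps_k / h_k. *)

(** * Differential calculus *)

Section Frechet.
Context {R : realType} {V W : normedModType R}.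

(** The obstacle is the smoothness of the frame: the definition of a curvature distribution yields
    eigenvectors point by point, with no choice that varies smoothly. The curvature normals are
    smooth by assumption, so the frame is extracted from them: the tangential part of D_Y v_j is
    -A_{v_j} Y, and because (v_j, v_k) = 0 for k <> j, the range of A_{v_j} is E_j alone.
    Normalising this vector gives eps_j as a field with values in the ambient space, where it is
    differentiated coordinate by coordinate, without covariant derivatives.

    Nondegeneracy enters as an equality of dimensions. The same count makes v |-> A_v injective and
    extends every normal vector to a normal field, so that conditions quantified over fields can be
    tested on single vectors.

    Once the cross terms are gone, closedness of theta_j is nothing but the symmetry of the second
    derivatives of u_j; this takes the place of Codazzi equations and of a Frobenius argument on Lie
    brackets. *)

Lemma is_diff_remainder (f : V -> W) (a : V) (df : {linear V -> W}) :
  continuous df ->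
  (forall e, 0 < e ->
     \forall h \near 0, `|f (h + a) - f a - df h| <= e * `|h|) ->
  is_diff a f df.
Proof.
move=> cdf hdf.
have E : f \o shift a = cst (f a) + df +o_ 0 id.
  apply/eqaddoP => e e0; near=> h.
  rewrite /= !fctE /= opprD addrA.
  by near: h; exact: hdf.
apply: DiffDef; last exact: diff_unique.
by apply/diff_locallyP; rewrite (diff_unique cdf E).
Unshelve. all: by end_near. Qed.

Lemma differentiable_remainder_le (f : V -> W) (a : V) e :
  differentiable f a -> 0 < e ->
  \forall h \near 0, `|f (h + a) - f a - 'd f a h| <= e * `|h|.
Proof.
move=> /diff_locally/eqaddoP + e0 => /(_ _ e0).
apply: filterS => h; by rewrite /= !fctE /= opprD addrA.
Qed.

Lemma near_eq_differentiable (f g : V -> W) (a : V) :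
  {near a, f =1 g} -> differentiable f a -> differentiable g a.
Proof.
move=> fg df; suff [] : is_diff a g ('d f a) by [].
apply: is_diff_remainder.
  exact: diff_continuous.
move=> e e0; near=> h.
have <- : f a = g a by exact: (nbhs_singleton fg).
have <- : f (h + a) = g (h + a).
  near: h; move: fg; rewrite {1}(near_shift 0) /=.
  by apply: filterS => h /=; rewrite subr0.
by near: h; exact: differentiable_remainder_le.
Unshelve. all: by end_near. Qed.

End Frechet.

(** * Row-vector maps, coordinate by coordinate *)

Section RowVectors.
Context {R : realType} {V : normedModType R} {n : nat}.
Implicit Types f : V -> 'rV[R]_n.

Lemma differentiable_rowP f a :
  differentiable f a <-> forall j, differentiable (fun x => f x 0 j) a.
Proof.
split=> [df j|df].
  apply: (@differentiable_comp _ _ _ _ f (fun M : 'rV[R]_n => M 0 j)) => //.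
  exact: differentiable_coord.
have E : \sum_(j < n) (fun x => f x 0 j *: delta_mx 0 j) = f.
  by apply/funext => x; rewrite fct_sumE -row_sum_delta.
rewrite -E; apply: (@differentiable_sum R V 'rV[R]_n) => j.
exact: differentiableZl.
Qed.

Lemma derive_rowE f a X j : differentiable f a ->
  'D_X f a 0 j = 'D_X (fun x => f x 0 j) a.
Proof. by move=> /(@diff_derivable _ _ _ _ _ X)/derive_mx ->; rewrite mxE. Qed.

Lemma continuous_rowP f a :
  {for a, continuous f} <-> forall j, {for a, continuous (fun x => f x 0 j)}.
Proof.
split=> [cf j|cf].
  by apply: (@continuous_comp _ _ _ f (fun M : 'rV[R]_n => M 0 j)) => //;
    exact: coord_continuous.
apply/cvgrPdist_lt => e e0; near=> x.
rewrite /Num.Def.normr/= mx_normrE; apply: bigmax_lt => //= -[i j] _ /=.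
rewrite !mxE (ord1 i); move: j {i}; near: x; apply: filter_forall => j.
exact: (cvgrPdist_lt _ _).1 (cf j) _ e0.
Unshelve. all: by end_near. Qed.

End RowVectors.

Lemma open_eq_near {T : topologicalType} {S : Type} (U : set T)
    (f g : T -> S) a : open U -> (forall b, U b -> f b = g b) -> U a ->
  {near a, f =1 g}.
Proof.
by move=> oU fg Ua; near=> b; apply: fg; near: b; exact: open_nbhs_nbhs.
Unshelve. all: by end_near. Qed.

(** * Scalar functions of class C^k and their algebra *)

Section ScalarCk.
Context {R : realType} {m : nat}.
Implicit Types (U : set 'rV[R]_m) (f g : 'rV[R]_m -> R).

(** Scalar counterpart of [Ck_on]. Products, inverses and square roots live in R, so smoothness of a
    vector field is always reduced to its coordinates by [Ck_on_coord]. *)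
Fixpoint sCk (k : nat) U f : Prop :=
  if k is k'.+1 then
    (forall a, U a -> differentiable f a) /\
    (forall X, sCk k' U (fun a => 'D_X f a))
  else forall a, U a -> {for a, continuous f}.

Lemma sCk_continuous k U f : sCk k U f -> forall a, U a -> {for a, continuous f}.
Proof.
case: k => [|k] //= [df _] a Ua; exact/differentiable_continuous/df.
Qed.

Lemma sCkW k U f : sCk k.+1 U f -> sCk k U f.
Proof.
elim: k f => [|k IH] f; first by move=> h; exact: (sCk_continuous h).
by move=> [df Df]; split=> // X; exact/IH/Df.
Qed.

Lemma sCk_sub k U U' f : U' `<=` U -> sCk k U f -> sCk k U' f.
Proof.
move=> sU; elim: k f => [|k IH] f; first by move=> h a /sU/h.
by move=> [df Df]; split=> [a /sU/df //|X]; exact/IH/Df.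
Qed.


(** On an open set, functions that agree have the same derivatives. Computation rules for
    derivatives hold on [U] only, so every induction on k below replaces a derivative by its formula
    through this lemma. *)
Lemma sCk_eq k U f g : open U -> (forall a, U a -> f a = g a) ->
  sCk k U f -> sCk k U g.
Proof.
move=> oU; elim: k f g => [|k IH] f g fg.
  move=> cf a Ua; have nfg := open_eq_near oU fg Ua.
  rewrite /continuous_at /prop_for -(fg _ Ua); apply: cvg_trans (cf a Ua).
  exact: near_eq_cvg nfg.
move=> [df Df]; split=> [a Ua|X].
  by apply: near_eq_differentiable (df _ Ua); exact: (open_eq_near oU fg Ua).
apply: IH (Df X) => a Ua; apply: near_eq_derive; exact: (open_eq_near oU fg Ua).
Qed.

Lemma sCk_cst k U (c : R) : sCk k U (fun=> c).
Proof.
elim: k c => [|k IH] c; first by move=> a _; exact: cst_continuous.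
split=> [a _|X]; first exact: (@differentiable_cst R 'rV[R]_m R c a).
suff -> : (fun a : 'rV[R]_m => 'D_X (fun=> c) a) = (fun=> 0) by [].
by apply/funext => a; exact: (derive_cst c a X).
Qed.

Lemma sCkD k U f g : open U -> sCk k U f -> sCk k U g ->
  sCk k U (fun a => f a + g a).
Proof.
move=> oU; elim: k f g => [|k IH] f g.
  by move=> cf cg a Ua; exact: (cvgD (cf a Ua) (cg a Ua)).
move=> [df Df] [dg Dg]; split=> [a Ua|X].
  exact: (differentiableD (df a Ua) (dg a Ua)).
apply: sCk_eq (IH _ _ (Df X) (Dg X)) => // a Ua.
by rewrite -[RHS]/('D_X (f + g) a) deriveD //; apply: diff_derivable; [exact: df|exact: dg].
Qed.

Lemma sCkM k U f g : open U -> sCk k U f -> sCk k U g ->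
  sCk k U (fun a => f a * g a).
Proof.
move=> oU; elim: k f g => [|k IH] f g.
  by move=> cf cg a Ua; exact: (cvgM (cf a Ua) (cg a Ua)).
move=> hf hg; have [df Df] := hf; have [dg Dg] := hg.
split=> [a Ua|X].
  exact: (differentiableM (df a Ua) (dg a Ua)).
have h : sCk k U (fun a => f a * 'D_X g a + g a * 'D_X f a).
  by apply: (sCkD oU); [exact: (IH _ _ (sCkW hf) (Dg X))|
                        exact: (IH _ _ (sCkW hg) (Df X))].
apply: sCk_eq h => // a Ua.
by rewrite -[RHS]/('D_X (f * g) a) deriveM //; apply: diff_derivable; [exact: df|exact: dg].
Qed.

Lemma sCkN k U f : open U -> sCk k U f -> sCk k U (fun a => - f a).
Proof.
move=> oU hf; apply: sCk_eq (sCkM oU (sCk_cst k U (-1)) hf) => // a _.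
by rewrite mulN1r.
Qed.

Lemma sCkB k U f g : open U -> sCk k U f -> sCk k U g ->
  sCk k U (fun a => f a - g a).
Proof. by move=> oU hf hg; apply: sCkD => //; exact: sCkN. Qed.

Lemma sCk_sum k U (I : Type) (r : seq I) (P : pred I) (F : I -> 'rV[R]_m -> R) :
  open U -> (forall i, P i -> sCk k U (F i)) ->
  sCk k U (fun a => \sum_(i <- r | P i) F i a).
Proof.
move=> oU hF; elim: r => [|i r IH].
  by apply: sCk_eq (sCk_cst k U 0) => // a _; rewrite big_nil.
case: (boolP (P i)) => Pi.
  by apply: sCk_eq (sCkD oU (hF i Pi) IH) => // a _; rewrite big_cons Pi.
by apply: sCk_eq IH => // a _; rewrite big_cons (negbTE Pi).
Qed.

Lemma sCk_prod k U (I : Type) (r : seq I) (P : pred I) (F : I -> 'rV[R]_m -> R) :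
  open U -> (forall i, P i -> sCk k U (F i)) ->
  sCk k U (fun a => \prod_(i <- r | P i) F i a).
Proof.
move=> oU hF; elim: r => [|i r IH].
  by apply: sCk_eq (sCk_cst k U 1) => // a _; rewrite big_nil.
case: (boolP (P i)) => Pi.
  by apply: sCk_eq (sCkM oU (hF i Pi) IH) => // a _; rewrite big_cons Pi.
by apply: sCk_eq IH => // a _; rewrite big_cons (negbTE Pi).
Qed.

(** The derivative of 1/f is a product of f' and two factors 1/f, and these are covered by the
    induction hypothesis one order lower. The square root is handled in the same way below. *)
Lemma sCkV k U f : open U -> (forall a, U a -> f a != 0) ->
  sCk k U f -> sCk k U (fun a => (f a)^-1).
Proof.
move=> oU f0; elim: k => [|k IH] hf.
  by move=> a Ua; exact: (cvgV (f0 a Ua) (hf a Ua)).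
have [df Df] := hf; have hV := IH (sCkW hf).
split=> [a Ua|X].
  exact: (differentiableV (df a Ua) (f0 a Ua)).
have h := sCkN oU (sCkM oU (Df X) (sCkM oU hV hV)).
apply: sCk_eq h => // a Ua.
rewrite -[RHS]/('D_X (fun y => (f y)^-1) a) deriveV ?f0 //; last first.
  by apply: diff_derivable; exact: df.
rewrite mulrC -mulNr /GRing.scale /=; congr (_ * _).
by rewrite expr2 invfM.
Qed.

Lemma differentiable_sqrt (x : R) : 0 < x -> differentiable Num.sqrt x.
Proof.
by move=> x0; apply/derivable1_diffP; have [] := is_derive1_sqrt x0.
Qed.

Lemma derive_comp_sqrt f a X : 0 < f a -> differentiable f a ->
  'D_X (fun b => Num.sqrt (f b)) a = 'D_X f a * (2 * Num.sqrt (f a))^-1.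
Proof.
move=> fa0 df.
have ds := differentiable_sqrt fa0.
rewrite -[LHS]/('D_X (Num.sqrt \o f) a) deriveE; last exact: differentiable_comp.
by rewrite diff_comp // /comp deriveE // diff1E // derive1E derive_sqrt.
Qed.

Lemma sCk_sqrt k U f : open U -> (forall a, U a -> 0 < f a) ->
  sCk k U f -> sCk k U (fun a => Num.sqrt (f a)).
Proof.
move=> oU f0; elim: k => [|k IH] hf.
  move=> a Ua; apply: (@continuous_comp _ _ _ f Num.sqrt); first exact: hf.
  exact: sqrt_continuous.
have [df Df] := hf; have hV := IH (sCkW hf).
split=> [a Ua|X].
  apply: (@differentiable_comp _ _ _ _ f Num.sqrt); first exact: df.
  exact/differentiable_sqrt/f0.
have h2 : sCk k U (fun a => (2 * Num.sqrt (f a))^-1).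
  apply: sCkV => // [a Ua|]; last by apply: sCkM => //; exact: sCk_cst.
  by rewrite mulf_neq0 // gt_eqF // sqrtr_gt0 f0.
apply: sCk_eq (sCkM oU (Df X) h2) => // a Ua.
by rewrite derive_comp_sqrt //; [exact: f0|exact: df].
Qed.

End ScalarCk.

(** * Vector-valued C^k maps: composition, determinants, inverse matrices *)

Section VectorCk.
Context {R : realType} {m : nat}.
Implicit Types (U : set 'rV[R]_m).

Lemma Ck_on_coord n k U (f : 'rV[R]_m -> 'rV[R]_n) : open U ->
  Ck_on k U f <-> forall j, sCk k U (fun a => f a 0 j).
Proof.
move=> oU; elim: k f => [|k IH] f.
  split=> [cf j a Ua|cf a Ua].
    by have /continuous_rowP := cf a Ua; exact.
  by apply/continuous_rowP => j; exact: cf.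
have DE X a j : differentiable f a ->
  'D_X f a 0 j = 'D_X (fun a => f a 0 j) a by exact: derive_rowE.
split=> [[df Df] j|h].
  split=> [a Ua|X]; first by have /differentiable_rowP := df a Ua; exact.
  have /(IH _) /(_ j) := Df X.
  by apply: sCk_eq => // a Ua; rewrite DE //; exact: df.
have df a : U a -> differentiable f a.
  by move=> Ua; apply/differentiable_rowP => j; exact: (h j).1.
split=> // X; apply/(IH _) => j.
by apply: sCk_eq ((h j).2 X) => // a Ua; rewrite DE //; exact: df.
Qed.

Lemma derive_basis (f : 'rV[R]_m -> R) a X : differentiable f a ->
  'D_X f a = \sum_j X 0 j * 'D_(basis_vec j) f a.
Proof.
move=> df; rewrite deriveE // {1}(row_sum_delta X) linear_sum.
by apply: eq_bigr => j _; rewrite linearZ deriveE.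
Qed.

Lemma derive_comp_rV p (f : 'rV[R]_m -> R) (h : 'rV[R]_p -> 'rV[R]_m) a X :
  differentiable h a -> differentiable f (h a) ->
  'D_X (fun b => f (h b)) a = \sum_j 'D_X h a 0 j * 'D_(basis_vec j) f (h a).
Proof.
move=> dh df; rewrite -derive_basis //.
have dc : differentiable (f \o h) a.
  exact: (@differentiable_comp _ _ _ _ h f).
by rewrite -[LHS]/('D_X (f \o h) a) !deriveE // diff_comp.
Qed.

(** By the chain rule the derivative is a sum of products of derivatives of h with partial
    derivatives of f composed with h; the latter are compositions of lower order, which is why the
    induction generalises over f. *)
Lemma sCk_comp p k (U : set 'rV[R]_p) (U' : set 'rV[R]_m)
    (f : 'rV[R]_m -> R) (h : 'rV[R]_p -> 'rV[R]_m) :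
  open U -> (forall a, U a -> U' (h a)) ->
  sCk k U' f -> (forall j, sCk k U (fun a => h a 0 j)) ->
  sCk k U (fun a => f (h a)).
Proof.
move=> oU hU; elim: k f => [|k IH] f hf hh.
  move=> a Ua; apply: (@continuous_comp _ _ _ h f); last exact/hf/hU.
  by apply/continuous_rowP => j; exact: hh.
have [df Df] := hf.
have dh a : U a -> differentiable h a.
  by move=> Ua; apply/differentiable_rowP => j; exact: (hh j).1.
split=> [a Ua|X].
  by apply: (@differentiable_comp _ _ _ _ h f); [exact: dh|exact/df/hU].
have h1 : sCk k U (fun a => \sum_j 'D_X h a 0 j * 'D_(basis_vec j) f (h a)).
  apply: sCk_sum => // j _; apply: sCkM => //.
    apply: sCk_eq ((hh j).2 X) => // a Ua.
    by rewrite derive_rowE //; exact: dh.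
  by apply: IH (Df _) _ => i; exact: sCkW (hh i).
apply: sCk_eq h1 => // a Ua.
by rewrite derive_comp_rV //; [exact: dh|exact/df/hU].
Qed.

Lemma sCk_det k U n (A : 'rV[R]_m -> 'M[R]_n) : open U ->
  (forall i j, sCk k U (fun a => A a i j)) -> sCk k U (fun a => \det (A a)).
Proof.
move=> oU hA; apply: sCk_sum => // s _; apply: sCkM => //; first exact: sCk_cst.
by apply: sCk_prod => // i _; exact: hA.
Qed.

(** Cramer's rule: an entry of the inverse is a cofactor divided by the determinant, both polynomial
    in the entries. *)
Lemma sCk_invmx k U n (A : 'rV[R]_m -> 'M[R]_n) : open U ->
  (forall i j, sCk k U (fun a => A a i j)) ->
  (forall a, U a -> A a \in unitmx) ->
  forall i j, sCk k U (fun a => invmx (A a) i j).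
Proof.
move=> oU hA uA i j.
have h : sCk k U (fun a => (\det (A a))^-1 * cofactor (A a) j i).
  apply: sCkM => //.
    apply: sCkV => //; last exact: sCk_det.
    by move=> a /uA; rewrite unitmxE unitfE.
  apply: sCkM => //; first exact: sCk_cst.
  apply: sCk_det => // u v.
  by apply: sCk_eq (hA (lift j u) (lift i v)) => // a Ua; rewrite !mxE.
by apply: sCk_eq h => // a Ua; rewrite /invmx (uA _ Ua) !mxE.
Qed.

End VectorCk.

(** * Restriction to lines and the mean value theorem *)

Section Lines.
Context {R : realType} {V : normedModType R}.
Implicit Types f : V -> R.

Lemma derivable_line f a X s :
  derivable f (a + s *: X) X -> derivable (fun t : R => f (a + t *: X)) s 1.
Proof.
rewrite /derivable => h; apply: (eq_ind _ (fun g : R -> R => cvg (g @ 0^')) h).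
apply/funext => k; congr (_ *: (f _ - _)).
by rewrite /= [k *: 1]mulr1 scalerDl addrCA.
Qed.

Lemma derive_line f a X s :
  'D_1 (fun t : R => f (a + t *: X)) s = 'D_X f (a + s *: X).
Proof.
rewrite /derive; apply: (congr1 (fun g : R -> R => lim (g @ 0^'))).
apply/funext => k; congr (_ *: (f _ - _)).
by rewrite /= [k *: 1]mulr1 scalerDl addrCA.
Qed.

Lemma MVT_line f a X h : 0 < h ->
  (forall s, 0 <= s <= h -> derivable f (a + s *: X) X) ->
  exists2 s, 0 <= s <= h & f (a + h *: X) - f a = h * 'D_X f (a + s *: X).
Proof.
move=> h0 df.
have [| |s] := @MVT_segment R (fun t : R => f (a + t *: X))
    (fun s => 'D_X f (a + s *: X)) 0 h (ltW h0).
- move=> s /[!in_itv] /= /andP[s0 sh]; apply: DeriveDef; last exact: derive_line.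
  by apply/derivable_line/df; rewrite !ltW.
- apply: derivable_within_continuous => s /[!in_itv] /= sh.
  exact/derivable_line/df.
rewrite in_itv /= => sh; rewrite scale0r addr0 subr0 mulrC.
by exists s.
Qed.

End Lines.

(** * Symmetry of second derivatives *)

Section Schwarz.
Context {R : realType} {m : nat}.
Implicit Types (U : set 'rV[R]_m).

(** The two mixed derivatives take a common value at two points arbitrarily close to a, so by
    continuity they differ at a by at most any e > 0. *)
Lemma derive_swap U (f : 'rV[R]_m -> R) a X Y : open U -> U a -> sCk 2 U f ->
  'D_X (fun b => 'D_Y f b) a = 'D_Y (fun b => 'D_X f b) a.
Proof.
move=> oU Ua [df Df].
have aux (e p q z : R) : `|p - z| < e / 2 -> `|q - z| < e / 2 -> `|p - q| <= e.
  move=> A B; rewrite (splitr e) -(subrKA z) -[z - q]opprB.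
  by rewrite (le_trans (ler_normD _ _)) // normrN lerD // ltW.
set L1 := LHS; set L2 := RHS.
suff H e : 0 < e -> `|L1 - L2| <= e.
  by apply/eqP; rewrite -subr_eq0 -normr_le0; apply/ler_addgt0Pl => e /H; rewrite addr0.
move=> e0.
have e20 : 0 < e / 2 by rewrite divr_gt0.
have [c1 c2] : {for a, continuous (fun b => 'D_X (fun b => 'D_Y f b) b)} /\
   {for a, continuous (fun b => 'D_Y (fun b => 'D_X f b) b)}.
  by split; [exact: ((Df Y).2 X)|exact: ((Df X).2 Y)].
have [r /= r0 ball_r] : exists2 r : R, 0 < r & forall b, `|a - b| < r ->
  [/\ U b, `|L1 - 'D_X (fun b => 'D_Y f b) b| < e / 2 &
   `|L2 - 'D_Y (fun b => 'D_X f b) b| < e / 2].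
  have nU : \forall b \near a, U b by exact: open_nbhs_nbhs.
  have n1 : \forall b \near a, `|L1 - 'D_X (fun b => 'D_Y f b) b| < e / 2.
    exact: (cvgrPdist_lt _ _).1 c1 _ e20.
  have n2 : \forall b \near a, `|L2 - 'D_Y (fun b => 'D_X f b) b| < e / 2.
    exact: (cvgrPdist_lt _ _).1 c2 _ e20.
  have /nbhs_ballP[r r0 hr] : \forall b \near a,
    [/\ U b, `|L1 - 'D_X (fun b => 'D_Y f b) b| < e / 2 &
     `|L2 - 'D_Y (fun b => 'D_X f b) b| < e / 2].
    by apply: filterS3 nU n1 n2 => b; split.
  by exists r => // b ab; apply: hr; rewrite -ball_normE.
(* With this step the parallelogram a + s X + t Y, 0 <= s, t <= h, stays in the ball of radius r,
   since h (|X| + |Y|) < r; the summand 1 keeps the denominator positive when X = Y = 0. *)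
pose h := r / (2 * (1 + `|X| + `|Y|)).
have K0 : 0 < 1 + `|X| + `|Y| by rewrite -addrA ltr_pwDl // addr_ge0.
have h0 : 0 < h by rewrite divr_gt0 // mulr_gt0.
have inr s t : 0 <= s <= h -> 0 <= t <= h -> `|a - (a + s *: X + t *: Y)| < r.
  move=> /andP[s0 sh] /andP[t0 th].
  rewrite -addrA opprD addNKr normrN.
  apply: (le_lt_trans (ler_normD _ _)); rewrite !normrZ !ger0_norm //.
  apply: (@le_lt_trans _ _ (h * `|X| + h * `|Y|)).
    by apply: lerD; apply: ler_wpM2r.
  rewrite -mulrDr /h mulrAC ltr_pdivrMr ?mulr_gt0 // ltr_pM2l //.
  have := normr_ge0 X; have := normr_ge0 Y; lra.
have hh : 0 <= h <= h by rewrite (ltW h0) lexx.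
have h00 : 0 <= (0 : R) <= h by rewrite lexx (ltW h0).
(* The second difference of f is expressed by the mean value theorem in both orders. *)
have key Z W :
   (forall s t, 0 <= s <= h -> 0 <= t <= h -> U (a + s *: Z + t *: W)) ->
   exists s t, [/\ 0 <= s <= h, 0 <= t <= h &
    (f (a + h *: Z + h *: W) - f (a + h *: Z)) - (f (a + h *: W) - f a)
     = h * (h * 'D_W (fun b => 'D_Z f b) (a + s *: Z + t *: W))].
  move=> inU.
  have inU0 s : 0 <= s <= h -> U (a + s *: Z).
    by move=> sh; have := inU s 0 sh h00; rewrite scale0r addr0.
  have dfd b : U b -> derivable f b Z by move=> Ub; exact/diff_derivable/df.
  have dfd2 s : 0 <= s <= h -> derivable (fun b => f (b + h *: W)) (a + s *: Z) Z.
    move=> sh; have := dfd _ (inU s h sh hh).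
    rewrite /derivable => H; apply: (eq_ind _ (fun g : R -> R => cvg (g @ 0^')) H).
    apply/funext => k /=.
    by rewrite !addrA.
  have d2E s : 'D_Z (fun b => f (b + h *: W)) (a + s *: Z) = 'D_Z f (a + s *: Z + h *: W).
    rewrite /derive; apply: (congr1 (fun g : R -> R => lim (g @ 0^'))); apply/funext => k /=.
    by rewrite !addrA.
  have [|s sh E] := @MVT_line R _ (fun b => f (b + h *: W) - f b) a Z h h0.
    by move=> s sh; apply: derivableB; [exact: dfd2|exact/dfd/inU0].
  have [|t th E2] := @MVT_line R _ (fun b => 'D_Z f b) (a + s *: Z) W h h0.
    by move=> t th; apply/diff_derivable/(Df Z).1/inU.
  exists s, t; split => //; rewrite E; congr (_ * _).
  apply: (etrans (deriveB (dfd2 s sh) (dfd _ (inU0 s sh)))).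
  exact: (etrans (congr1 (fun z => z - _) (d2E s)) E2).
have inU s t : 0 <= s <= h -> 0 <= t <= h -> U (a + s *: X + t *: Y).
  by move=> sh th; have [] := ball_r _ (inr s t sh th).
have [s [t [sh th E1]]] := key X Y inU.
have [t' [s' [th' sh' E2]]] := key Y X
  (fun t s th sh => eq_ind _ U (inU s t sh th) _ (addrAC _ _ _)).
have E : 'D_Y (fun b => 'D_X f b) (a + s *: X + t *: Y)
   = 'D_X (fun b => 'D_Y f b) (a + s' *: X + t' *: Y).
  rewrite (addrAC a (s' *: X)).
  have hN : h != 0 by rewrite gt_eqF.
  have cancel x y z w : x = h * (h * z) -> y = h * (h * w) -> x = y -> z = w.
    by move=> -> -> /(mulfI hN)/(mulfI hN).
  apply: (cancel _ _ _ _ E1 E2); rewrite (addrAC a (h *: Y)).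
  move: (f (a + h *: X + h *: Y)) (f (a + h *: X)) (f (a + h *: Y)) (f a).
  by move=> p q r1 w; ring.
have [_ _ A] := ball_r _ (inr s t sh th).
have [_ B _] := ball_r _ (inr s' t' sh' th').
rewrite E in A; exact: (aux _ _ _ _ B A).
Qed.

End Schwarz.
Section RowNorm.
Context {R : realType} {n : nat}.

Lemma row_norm_coord (x : 'rV[R]_n) j : `|x 0 j| <= `|x|.
Proof.
rewrite [leRHS]/Num.Def.normr/= mx_normrE.
exact: (le_bigmax _ (fun ij : 'I_1 * 'I_n => `|x ij.1 ij.2|) (0, j)).
Qed.

Lemma row_norm_le (x : 'rV[R]_n) c : 0 <= c -> (forall j, `|x 0 j| <= c) -> `|x| <= c.
Proof.
move=> c0 h; rewrite /Num.Def.normr/= mx_normrE; apply: bigmax_le => //= -[i j] _.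
by rewrite /= (ord1 i).
Qed.

End RowNorm.

Lemma norm_mulmx_le {R : realType} n m (A : 'M[R]_(n, m)) : exists2 C, 0 < C &
  forall x : 'rV[R]_n, `|x *m A| <= C * `|x|.
Proof.
pose C := 1 + \sum_j \sum_i `|A i j|.
have S0 j : 0 <= \sum_i `|A i j| by apply: sumr_ge0.
have C0 : 0 < C by rewrite ltr_pwDl // sumr_ge0.
exists C => // x; apply: row_norm_le => [|j]; first by rewrite mulr_ge0 // ltW.
rewrite mxE; apply: (le_trans (ler_norm_sum _ _ _)).
apply: (@le_trans _ _ (\sum_i `|A i j| * `|x|)).
  by apply: ler_sum => i _; rewrite normrM mulrC ler_wpM2l // row_norm_coord.
rewrite -mulr_suml ler_wpM2r // /C (bigD1 j) //= addrA addrAC lerDr.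
by rewrite addr_ge0 // sumr_ge0.
Qed.

(** * Functions with a prescribed gradient *)

Section Gradients.
Context {R : realType} {m : nat}.
Implicit Types (U : set 'rV[R]_m).

Lemma derive_coord (a X : 'rV[R]_m) j : 'D_X (fun a : 'rV[R]_m => a 0 j) a = X 0 j.
Proof. by rewrite -(@derive_rowE _ _ _ id a X j) ?derive_id. Qed.

Lemma sCk_coord k U j : sCk k U (fun a : 'rV[R]_m => a 0 j).
Proof.
case: k => [|k]; first by move=> a _; exact: coord_continuous.
split=> [a _|X]; first exact: differentiable_coord.
suff -> : (fun a : 'rV[R]_m => 'D_X (fun a : 'rV[R]_m => a 0 j) a) = (fun=> X 0 j).
  exact: sCk_cst.
by apply/funext => a; exact: derive_coord.
Qed.

Section RowForm.
Variable c : 'rV[R]_m.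
(** Packaged as a linear map in order to serve as the candidate differential in
    [is_diff_remainder]. *)
Definition row_form (X : 'rV[R]_m) : R := \sum_j X 0 j * c 0 j.

Fact row_form_linear : linear row_form.
Proof.
move=> k X Y; rewrite /row_form scaler_sumr -big_split /=; apply: eq_bigr => j _.
by rewrite !mxE mulrDl /GRing.scale /= mulrA.
Qed.
HB.instance Definition _ := GRing.isLinear.Build R 'rV[R]_m R _ row_form row_form_linear.

Lemma row_form_continuous : continuous row_form.
Proof.
move=> a; apply: (@sCk_continuous _ _ 0 setT) => //.
apply: sCk_sum => [|j _]; first exact: openT.
by apply: sCkM; [exact: openT|exact: sCk_coord|exact: sCk_cst].
Qed.
End RowForm.

Variables (U : set 'rV[R]_m) (f : 'rV[R]_m -> R) (theta : 'I_m -> 'rV[R]_m -> R).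
Hypothesis oU : open U.
Hypothesis dfU : forall a X, U a -> derivable f a X.
Hypothesis DfU : forall a X, U a -> 'D_X f a = \sum_j X 0 j * theta j a.

(** By the mean value theorem on the segment from a to a + h, the remainder is a sum of terms h_j
    (theta_j (a + s h) - theta_j a), and continuity of theta at a makes it o(h). *)
Lemma continuous_gradient_differentiable a :
  U a -> (forall j, {for a, continuous (theta j)}) -> differentiable f a.
Proof.
move=> Ua ct.
suff [] : is_diff a f (row_form (\row_j theta j a)) by [].
apply: (@is_diff_remainder _ _ _ _ _ (row_form (\row_j theta j a))).
  exact: row_form_continuous.
move=> e e0.
(* The m terms of the remainder share the error e; [m.+1] instead of [m] avoids a division by
   zero. *)
have e'0 : 0 < e / (m.+1)%:R by rewrite divr_gt0.
have nt : \forall b \near a, forall j, `|theta j a - theta j b| < e / m.+1%:R.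
  have h j : \forall b \near a, `|theta j a - theta j b| < e / m.+1%:R.
    exact: (cvgrPdist_lt _ _).1 (ct j) _ e'0.
  exact: filter_forall h.
have nU : \forall b \near a, U b by exact: open_nbhs_nbhs.
have /nbhs_ballP[r /= r0 hr] : \forall b \near a, U b /\
   forall j, `|theta j a - theta j b| < e / m.+1%:R.
  by apply: filterS2 nU nt => b.
apply/nbhs_ballP; exists r => // h; rewrite -ball_normE /= sub0r normrN => hh.
have inr s : 0 <= s <= 1 -> ball a r (a + s *: h).
  move=> /andP[s0 s1]; rewrite -ball_normE /= opprD addNKr normrN normrZ ger0_norm //.
  by rewrite (le_lt_trans _ hh) // ler_piMl.
have [|s s01 E] := @MVT_line _ _ f a h 1 ltr01.
  by move=> s s01; apply: dfU; have [] := hr _ (inr s s01).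
have [Us ts] := hr _ (inr s s01).
rewrite [h + a]addrC; rewrite scale1r mul1r in E; rewrite {}E.
rewrite DfU // /row_form -sumrB.
apply: (le_trans (ler_norm_sum _ _ _)).
apply: (@le_trans _ _ (\sum_(j < m) `|h| * (e / m.+1%:R))).
  apply: ler_sum => j _; rewrite mxE -mulrBr normrM distrC.
  by apply: ler_pM => //; [exact: row_norm_coord|exact/ltW/ts].
rewrite sumr_const card_ord -[leLHS]mulr_natr -mulrA mulrC ler_wpM2r // -mulrA.
by rewrite ler_piMr ?(ltW e0) // mulrC ler_pdivrMr // mul1r ler_nat.
Qed.

(** A function is one order smoother than its gradient; applied at every order, this makes the
    primitive of a smooth closed form smooth. *)
Lemma sCk_gradient k : (forall j, sCk k U (theta j)) -> sCk k.+1 U f.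
Proof.
move=> ht; split=> [a Ua|X].
  by apply: continuous_gradient_differentiable => // j; exact: sCk_continuous (ht j) _ Ua.
have h : sCk k U (fun a => \sum_j X 0 j * theta j a).
  by apply: sCk_sum => // j _; apply: sCkM => //; exact: sCk_cst.
by apply: sCk_eq h => // a Ua; rewrite DfU.
Qed.

End Gradients.

Lemma mulmxr_continuous {R : realType} m n (A : 'M[R]_(m, n)) :
  continuous (fun z : 'rV[R]_m => z *m A).
Proof.
move=> z; apply/continuous_rowP => j; apply: (@sCk_continuous _ _ 0 setT) => //.
have h : sCk 0 setT (fun z : 'rV[R]_m => \sum_k z 0 k * A k j).
  apply: sCk_sum => [|k _]; first exact: openT.
  by apply: sCkM; [exact: openT|exact: sCk_coord|exact: sCk_cst].
by apply: sCk_eq h; [exact: openT|move=> b _; rewrite mxE].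
Qed.
Lemma sum_continuous {R : realType} {T : topologicalType} (I : Type) (s : seq I)
    (F : I -> T -> R) t : (forall i, {for t, continuous (F i)}) ->
  {for t, continuous (fun x => \sum_(i <- s) F i x)}.
Proof.
move=> cF; elim: s => [|i s IH]; rewrite /continuous_at /prop_for.
  by rewrite big_nil; under eq_fun do rewrite big_nil; exact: cvg_cst.
rewrite big_cons; under eq_fun do rewrite big_cons.
exact: (cvgD (cF i) IH).
Qed.

(** * The Poincare lemma on a ball *)

Section PoincareBall.
Context {R : realType} {m : nat}.
Variables (a0 : 'rV[R]_m) (r : R) (theta : 'I_m -> 'rV[R]_m -> R).
Local Notation B := (ball a0 r).
Hypothesis r0 : 0 < r.
Hypothesis theta1 : forall j, sCk 1 B (theta j).
Hypothesis closed_theta : forall i j (a : 'rV[R]_m), B a ->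
  'D_(basis_vec i) (theta j) a = 'D_(basis_vec j) (theta i) a.
Variable C : R.
Hypothesis C0 : 0 <= C.
Hypothesis theta_bounded : forall j (a : 'rV[R]_m), B a -> `|theta j a| <= C.
Hypothesis dtheta_bounded : forall i j (a : 'rV[R]_m), B a ->
  `|'D_(basis_vec i) (theta j) a| <= C.

Let mu := @lebesgue_measure R.
Let ray (b : 'rV[R]_m) (t : R) := a0 + t *: (b - a0).
Let integrand (b : 'rV[R]_m) (t : R) := \sum_j (b - a0) 0 j * theta j (ray b t).

(** The integral of theta along the segment from a0 to b. The bounds by [C] assumed above supply the
    dominating constant for differentiation under the integral sign. *)
Definition radial_primitive (b : 'rV[R]_m) : R :=
  \int[mu]_(t in `[0, 1]) integrand b t.

Let BE (b : 'rV[R]_m) : B b <-> `|b - a0| < r.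
Proof. by rewrite -ball_normE /= distrC. Qed.

Let ray_ball b t : B b -> 0 <= t <= 1 -> B (ray b t).
Proof.
move=> /BE bB /andP[t0 t1]; apply/BE; rewrite /ray addrAC subrr add0r normrZ.
by rewrite ger0_norm // (le_lt_trans _ bB) // ler_piMl.
Qed.

Let ray_continuous b t : {for t, continuous (ray b)}.
Proof. by apply: cvgD; [exact: cvg_cst|apply: cvgZr_tmp; exact: cvg_id]. Qed.

Let d_theta j (a : 'rV[R]_m) : B a -> differentiable (theta j) a.
Proof. by move=> Ba; exact: (theta1 j).1. Qed.

Let theta_ray_continuous b j t : B b -> 0 <= t <= 1 ->
  {for t, continuous (fun t => theta j (ray b t))}.
Proof.
move=> Bb t01; apply: (@continuous_comp _ _ _ (ray b) (theta j)) => //.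
exact: (sCk_continuous (theta1 j) (ray_ball Bb t01)).
Qed.

Let Dtheta_ray_continuous b X j t : B b -> 0 <= t <= 1 ->
  {for t, continuous (fun t => 'D_X (theta j) (ray b t))}.
Proof.
move=> Bb t01; apply: (@continuous_comp _ _ _ (ray b) (fun a => 'D_X (theta j) a)) => //.
exact: ((theta1 j).2 X) _ (ray_ball Bb t01).
Qed.

Let within01 (f : R -> R) : (forall t, 0 <= t <= 1 -> {for t, continuous f}) ->
  {within `[0, 1], continuous f}.
Proof.
move=> cf; apply: continuous_in_subspaceT => t /set_mem /=.
by rewrite in_itv /= => t01; exact: cf.
Qed.

Let integrable01 (f : R -> R) : (forall t, 0 <= t <= 1 -> {for t, continuous f}) ->
  mu.-integrable `[0, 1] (EFin \o f).
Proof.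
move=> cf; apply: continuous_compact_integrable; first exact: segment_compact.
exact: within01.
Qed.

Let integrand_continuous b t : B b -> 0 <= t <= 1 ->
  {for t, continuous (integrand b)}.
Proof.
move=> Bb t01; apply: sum_continuous => j; apply: cvgM; first exact: cvg_cst.
exact: theta_ray_continuous.
Qed.

(** The derivative of the integrand when b moves in direction X at fixed t. The factor t comes from
    the chain rule: the point of the ray at time t moves by t X. *)
Let dintegrand (b X : 'rV[R]_m) (t : R) : R :=
  \sum_j (X 0 j * theta j (ray b t) +
          (b - a0) 0 j * (t * 'D_X (theta j) (ray b t))).

Let is_derive_integrand b X s t : B (b + s *: X) -> 0 <= t <= 1 ->
  is_derive s 1 (fun s : R => integrand (b + s *: X) t) (dintegrand (b + s *: X) X t).
Proof.
move=> Bs t01; rewrite /integrand /dintegrand.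
have rayE u : ray (b + u *: X) t = ray b t + u *: (t *: X).
  by rewrite /ray [b + _]addrC -addrA scalerDr scalerA mulrC -scalerA addrCA addrC.
pose h j (u : R) := (b + u *: X - a0) 0 j * theta j (ray (b + u *: X) t).
have dh j : is_derive s 1 (h j) (X 0 j * theta j (ray (b + s *: X) t) +
     (b + s *: X - a0) 0 j * (t * 'D_X (theta j) (ray (b + s *: X) t))).
  have dth := d_theta j (ray_ball Bs t01); rewrite rayE in dth *.
  have d2 : is_derive s 1 (fun u : R => theta j (ray b t + u *: (t *: X)))
      (t * 'D_X (theta j) (ray b t + s *: (t *: X))).
    apply: DeriveDef; first exact/derivable_line/diff_derivable.
    by rewrite derive_line !deriveE // linearZ.
  have d1 : is_derive s 1 (fun u : R => (b + u *: X - a0) 0 j) (X 0 j).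
    under eq_fun do rewrite addrAC.
    apply: DeriveDef; last by rewrite (derive_line (fun a : 'rV[R]_m => a 0 j)) derive_coord.
    apply: (@derivable_line _ _ (fun a : 'rV[R]_m => a 0 j)).
    exact/diff_derivable/differentiable_coord.
  rewrite /h; under eq_fun do rewrite rayE.
  apply: is_derive_eq (is_deriveM d1 d2) _.
  by rewrite /GRing.scale /= addrC [X in X + _]mulrC.
have := @is_derive_sum R R R m h s 1 _ dh.
by rewrite fct_sumE.
Qed.

Let dintegrand_le b X t : B b -> 0 <= t <= 1 ->
  `|dintegrand b X t| <= m%:R * (`|X| * C + r * (m%:R * `|X| * C)).
Proof.
move=> Bb t01; have Br := ray_ball Bb t01.
apply: (le_trans (ler_norm_sum _ _ _)).
apply: (@le_trans _ _ (\sum_(j < m) (`|X| * C + r * (m%:R * `|X| * C)))); last first.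
  by rewrite sumr_const card_ord -[leLHS]mulr_natr mulrC.
apply: ler_sum => j _; apply: (le_trans (ler_normD _ _)); apply: lerD.
  by rewrite normrM; apply: ler_pM => //; [exact: row_norm_coord|exact: theta_bounded].
rewrite normrM; apply: ler_pM => //.
  by apply: (le_trans (row_norm_coord _ _)); apply/ltW/BE.
case/andP: t01 => t0 t1; rewrite normrM ger0_norm //.
apply: (@le_trans _ _ (1 * `|'D_X (theta j) (ray b t)|)); first exact: ler_wpM2r.
rewrite mul1r derive_basis; last exact: d_theta.
apply: (le_trans (ler_norm_sum _ _ _)).
apply: (@le_trans _ _ (\sum_(j < m) (`|X| * C))); last first.
  by rewrite sumr_const card_ord -[leLHS]mulr_natr mulrC mulrA.
apply: ler_sum => i _; rewrite normrM.
by apply: ler_pM => //; [exact: row_norm_coord|exact: dtheta_bounded].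
Qed.

(** Closedness of theta turns the integrand into the t-derivative of H t = t theta_{ray t}(X); the
    fundamental theorem of calculus leaves H 1 - H 0, and H 0 = 0. *)
Let integral_dintegrand b X : B b ->
  \int[mu]_(t in `[0, 1]) dintegrand b X t = \sum_j X 0 j * theta j b.
Proof.
move=> Bb.
pose H (t : R) := t * \sum_j X 0 j * theta j (ray b t).
have dH (t : R) : 0 <= t <= 1 -> is_derive t 1 H (dintegrand b X t).
  move=> t01; have Br := ray_ball Bb t01.
  have d1 : is_derive t 1 (fun t : R => \sum_j X 0 j * theta j (ray b t))
     (\sum_j X 0 j * 'D_(b - a0) (theta j) (ray b t)).
    have dh j : is_derive t 1 (fun t : R => X 0 j * theta j (ray b t))
        (X 0 j * 'D_(b - a0) (theta j) (ray b t)).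
      have d2 : is_derive t 1 (fun t : R => theta j (ray b t))
          ('D_(b - a0) (theta j) (ray b t)).
        by apply: DeriveDef; [exact/derivable_line/diff_derivable/d_theta|
                              rewrite derive_line].
      exact: is_deriveZ.
    by have := @is_derive_sum R R R m _ t 1 _ dh; rewrite fct_sumE.
  apply: is_derive_eq (is_deriveM (is_derive_id t 1) d1) _.
  rewrite /dintegrand big_split /= /GRing.scale /= mulr1 addrC; congr (_ + _).
  rewrite mulr_sumr.
  transitivity (\sum_j \sum_i
      t * (X 0 j * ((b - a0) 0 i * 'D_(basis_vec i) (theta j) (ray b t)))).
    apply: eq_bigr => j _; rewrite derive_basis; last exact: d_theta.
    by rewrite mulr_sumr mulr_sumr.
  rewrite exchange_big /=; apply: eq_bigr => i _.
  rewrite derive_basis; last exact: d_theta.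
  rewrite !mulr_sumr; apply: eq_bigr => j _.
  by rewrite (closed_theta i j Br); ring.
have cd (t : R) : 0 <= t <= 1 -> {for t, continuous (dintegrand b X)}.
  move=> t01; apply: sum_continuous => j; apply: cvgD.
    by apply: cvgM; [exact: cvg_cst|exact: theta_ray_continuous].
  apply: cvgM; first exact: cvg_cst.
  by apply: cvgM; [exact: cvg_id|exact: Dtheta_ray_continuous].
have cH (t : R) : 0 <= t <= 1 -> {for t, continuous H}.
  by move=> t01; apply/differentiable_continuous/derivable1_diffP; have [] := dH t t01.
rewrite /Rintegral (@continuous_FTC2 _ _ H) ?ltr01 //.
- rewrite /= /H mul0r subr0 mul1r; apply: eq_bigr => j _.
  by rewrite /ray scale1r addrC subrK.
- exact: within01.
- split.
  + move=> t; rewrite in_itv /= => /andP[t0 t1].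
    by have [] := dH t; rewrite ?(ltW t0) ?(ltW t1).
  + by apply: cvg_at_right_filter; apply: cH; rewrite lexx ler01.
  + by apply: cvg_at_left_filter; apply: cH; rewrite lexx ler01.
- move=> t; rewrite in_itv /= => /andP[t0 t1].
  by rewrite derive1E; apply: derive_val; apply: dH; rewrite !ltW.
Qed.

Lemma is_derive_radial_primitive b X : B b ->
  is_derive b X radial_primitive (\sum_j X 0 j * theta j b).
Proof.
move=> Bb.
(* Differentiation under the integral takes place over an open interval of parameters s, so b + s X
   has to stay in the ball for all |s| < d. *)
have [d d0 hd] : exists2 d : R, 0 < d & forall s : R, `|s| < d -> B (b + s *: X).
  have X0 : 0 < 1 + `|X| by rewrite ltr_pwDl.
  exists ((r - `|b - a0|) / (1 + `|X|)).
    by rewrite divr_gt0 // subr_gt0; apply/BE.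
  move=> s; rewrite ltr_pdivlMr // => hs; apply/BE.
  rewrite addrAC; apply: (le_lt_trans (ler_normD _ _)); rewrite normrZ.
  rewrite -ltrBrDl (le_lt_trans _ hs) // ler_wpM2l //.
  by rewrite lerDr.
have Is (s : R) : `]-d, d[%classic s -> B (b + s *: X).
  by rewrite /= in_itv /= -ltr_norml; exact: hd.
pose f (s t : R) := integrand (b + s *: X) t.
have in01 (t : R) : `[0, 1]%classic t -> 0 <= t <= 1 by rewrite /= in_itv.
have I0 : `]-d, d[%classic (0 : R) by rewrite /= in_itv /= d0 oppr_lt0 d0.
have df s t : `]-d, d[%classic s -> `[0, 1]%classic t ->
    is_derive s 1 (f ^~ t) (dintegrand (b + s *: X) X t).
  by move=> /Is Bs /in01; exact: is_derive_integrand.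
(* The bound of [dintegrand_le], which depends neither on s nor on t. *)
pose K : R := m%:R * (`|X| * C + r * (m%:R * `|X| * C)).
have K0 : 0 <= K by rewrite !(mulr_ge0, addr_ge0) // ltW.
have intf s : `]-d, d[%classic s -> mu.-integrable `[0, 1] (EFin \o f s).
  by move=> /Is Bs; apply: integrable01 => t; exact: integrand_continuous.
have derf s t (Is' : `]-d, d[%classic s) (It : `[0, 1]%classic t) :
  derivable (f ^~ t) s 1 by have [] := df s t Is' It.
have intK : mu.-integrable `[0, 1] (EFin \o (cst K : R -> R)).
  by apply: integrable01 => t _; exact: cst_continuous.
have leK s t : `]-d, d[%classic s -> `[0, 1]%classic t -> `|partial1of2 f s t| <= K.
  move=> Iss It; rewrite partial1of2E (@derive_val _ _ _ _ _ _ _ (df s t Iss It)).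
  exact: dintegrand_le (Is _ Iss) (in01 _ It).
have m01 : measurable (`[0, 1]%classic : set (measurableTypeR R)) by exact: measurable_itv.
have fE : (fun s : R => radial_primitive (b + s *: X)) =
  (fun s => \int[mu]_(t in `[0, 1]) f s t) by [].
have dF := derivable_under_integral m01 I0 intf derf (fun=> K0) intK leK.
have DF := differentiation_under_integral m01 I0 intf derf (fun=> K0) intK leK.
rewrite -fE in dF; rewrite -fE derive1E in DF.
apply: DeriveDef.
  by apply/derivable1P; under eq_fun do rewrite addrC.
rewrite derive_line scale0r addr0 in DF; rewrite DF -integral_dintegrand //.
apply: eq_Rintegral => t /set_mem It.
rewrite partial1of2E (@derive_val _ _ _ _ _ _ _ (df 0 t I0 It)).
by rewrite scale0r addr0.
Qed.

End PoincareBall.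
Lemma local_bound {R : realType} {T : topologicalType} {I : finType}
    (phi : I -> T -> R) a : (forall i, {for a, continuous (phi i)}) ->
  exists2 C, 0 <= C & \forall b \near a, forall i, `|phi i b| <= C.
Proof.
move=> cphi; exists (1 + \sum_i `|phi i a|); first by rewrite addr_ge0 // sumr_ge0.
have h i : \forall b \near a, `|phi i b| <= 1 + \sum_i `|phi i a|.
  have : \forall b \near a, `|phi i a - phi i b| < 1.
    exact: (cvgrPdist_lt _ _).1 (cphi i) _ ltr01.
  apply: filterS => b hb.
  rewrite -(subrK (phi i a) (phi i b)) (le_trans (ler_normD _ _)) // lerD //.
    by rewrite distrC ltW.
  by rewrite (bigD1 i) //= lerDl sumr_ge0.
exact: filter_forall h.
Qed.

(** One radius serves all p forms, so that their primitives can be the coordinates of a single map.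
    It is chosen so small that continuity at a0 bounds all coefficients and their first partial
    derivatives. *)
Lemma closed_forms_exact {R : realType} {m p : nat} (U : set 'rV[R]_m)
    (a0 : 'rV[R]_m) (theta : 'I_p -> 'I_m -> 'rV[R]_m -> R) :
  open U -> U a0 -> (forall i j k, sCk k U (theta i j)) ->
  (forall i j k a, U a ->
     'D_(basis_vec j) (theta i k) a = 'D_(basis_vec k) (theta i j) a) ->
  exists2 r : R, 0 < r /\ ball a0 r `<=` U &
  exists f : 'I_p -> 'rV[R]_m -> R, forall i,
    (forall k, sCk k (ball a0 r) (f i)) /\
    (forall a X, ball a0 r a -> 'D_X (f i) a = \sum_j X 0 j * theta i j a).
Proof.
move=> oU Ua0 sth cth.
have [C1 C10 b1] := @local_bound R _ _
  (fun ij : 'I_p * 'I_m => theta ij.1 ij.2) a0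
  (fun ij => sCk_continuous (sth ij.1 ij.2 0%N) Ua0).
have [C2 C20 b2] := @local_bound R _ _
  (fun ij : 'I_p * ('I_m * 'I_m) =>
    (fun a : 'rV[R]_m => 'D_(basis_vec ij.2.1) (theta ij.1 ij.2.2) a)) a0
  (fun ij => ((sth ij.1 ij.2.2 1%N).2 _) a0 Ua0).
have nU : \forall b \near a0, U b by exact: open_nbhs_nbhs.
have /nbhs_ballP[r /= r0 hr] : \forall b \near a0, [/\ U b,
    forall ij : 'I_p * 'I_m, `|theta ij.1 ij.2 b| <= C1 &
    forall ij : 'I_p * ('I_m * 'I_m),
      `|'D_(basis_vec ij.2.1) (theta ij.1 ij.2.2) b| <= C2].
  by apply: filterS3 nU b1 b2 => b.
have rU : ball a0 r `<=` U by move=> b /hr[].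
exists r => //; exists (fun i => radial_primitive a0 (theta i)) => i.
have D a X : ball a0 r a ->
    is_derive a X (radial_primitive a0 (theta i)) (\sum_j X 0 j * theta i j a).
  apply: (@is_derive_radial_primitive _ _ _ _ (theta i) r0 _ _ (C1 + C2)).
  - by move=> j; exact: sCk_sub (sth i j 1%N).
  - by move=> j k b /rU Ub; exact: cth.
  - exact: addr_ge0.
  - by move=> j b /hr[_ /(_ (i, j)) h _]; apply: (le_trans h); rewrite lerDl.
  - by move=> j k b /hr[_ _ /(_ (i, (j, k))) h]; apply: (le_trans h); rewrite lerDr.
have oB : open (ball a0 r) by exact: ball_open.
split=> [k|a X Ba]; last by apply: derive_val; exact: D.
apply: sCkW; apply: (@sCk_gradient _ _ _ _ (theta i)) => //.
- by move=> a X Ba; have [] := D a X Ba.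
- by move=> a X Ba; apply: derive_val; exact: D.
- by move=> j; exact: sCk_sub (sth i j k).
Qed.

Lemma derive_lincomb {R : realType} {V : normedModType R} n
    (F : 'I_n -> V -> R) (c : 'I_n -> R) a X :
  (forall k, differentiable (F k) a) ->
  is_derive a X (fun b => \sum_k F k b * c k) (\sum_k 'D_X (F k) a * c k).
Proof.
move=> dF.
have d k : is_derive a X (fun b => F k b * c k) ('D_X (F k) a * c k).
  have h := derivableP (diff_derivable (v := X) (dF k)).
  rewrite [X in is_derive _ _ _ X]mulrC; under eq_fun do rewrite mulrC.
  exact: is_deriveZ.
by have := @is_derive_sum R V R n _ a X _ d; rewrite fct_sumE.
Qed.

Lemma ball_segment {R : realType} {V : normedModType R} (a0 a b : V) (r s : R) :
  ball a0 r a -> ball a0 r b -> 0 <= s <= 1 -> ball a0 r (b + s *: (a - b)).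
Proof.
rewrite -ball_normE /= => ha hb /andP[s0 s1].
have -> : a0 - (b + s *: (a - b)) = s *: (a0 - a) + (1 - s) *: (a0 - b).
  rewrite scalerBl scale1r addrCA -scalerBr opprD addrA -scalerN opprB.
  by congr (_ + _ *: _); rewrite [RHS]addrC opprB addrA subrK.
apply: (le_lt_trans (ler_normD _ _)); rewrite !normrZ !ger0_norm ?subr_ge0 //.
have [->|sN] := eqVneq s 0; first by rewrite mul0r add0r subr0 mul1r.
have sp : 0 < s by rewrite lt_neqAle eq_sym sN.
have -> : r = s * r + (1 - s) * r by ring.
apply: ltr_leD; first by rewrite ltr_pM2l.
by rewrite ler_wpM2l ?subr_ge0 //; exact: ltW.
Qed.

(** * The inverse function theorem *)

Section InverseFunction.
Context {R : realType} {n : nat}.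
Variables (U : set 'rV[R]_n) (x : 'rV[R]_n -> 'rV[R]_n) (a0 : 'rV[R]_n).
Hypothesis oU : open U.
Hypothesis Ua0 : U a0.
Hypothesis sx : smooth_on U x.

Let sxj k j : sCk k U (fun a => x a 0 j).
Proof. by move: (sx k) => /(Ck_on_coord _ _ oU); exact. Qed.

Let dx a : U a -> differentiable x a.
Proof. by move=> Ua; exact: (sx 1).1. Qed.

Lemma sCk_jacobian k i j : sCk k U (fun a => 'J x a i j).
Proof.
apply: sCk_eq ((sxj k.+1 j).2 (basis_vec i)) => // a Ua.
rewrite -derive_rowE; last exact: dx.
by rewrite deriveEjacobian; [rewrite -rowE mxE|exact: dx].
Qed.

(* The Jacobian [1 - 'J x a *m A] of [a - x a *m A] is small near a0. *)
Lemma near_contraction (A : 'M[R]_n) : 'J x a0 *m A = 1%:M ->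
  exists2 r, 0 < r /\ ball a0 r `<=` U & forall a b, ball a0 r a -> ball a0 r b ->
    `|(a - x a *m A) - (b - x b *m A)| <= 2^-1 * `|a - b|.
Proof.
move=> JA.
(* n matrix entries of size e add up to at most 1/2. *)
pose e : R := 2^-1 / n.+1%:R.
have e0 : 0 < e by rewrite divr_gt0 ?invr_gt0.
pose E (ij : 'I_n * 'I_n) a := (1%:M - 'J x a *m A) ij.1 ij.2.
have cE ij : {for a0, continuous (E ij)}.
  apply: (@sCk_continuous _ _ 0 U) => //.
  have h : sCk 0 U (fun a => (1%:M : 'M[R]_n) ij.1 ij.2 -
      \sum_k 'J x a ij.1 k * A k ij.2).
    apply: sCkB => //; first exact: sCk_cst.
    apply: sCk_sum => // k _; apply: sCkM => //; last exact: sCk_cst.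
    exact: sCk_jacobian.
  by apply: sCk_eq h => // a Ua; rewrite /E !mxE.
have nE ij : \forall a \near a0, `|E ij a| < e.
  have : \forall a \near a0, `|E ij a0 - E ij a| < e.
    exact: (cvgrPdist_lt _ _).1 (cE ij) _ e0.
  by apply: filterS => a; rewrite {1}/E JA subrr mxE sub0r normrN.
have nU : \forall b \near a0, U b by exact: open_nbhs_nbhs.
have /nbhs_ballP[r /= r0 hr] : \forall b \near a0, U b /\ forall ij, `|E ij b| < e.
  have nE' : \forall b \near a0, forall ij, `|E ij b| < e by exact: filter_forall nE.
  by apply: filterS2 nU nE' => b.
exists r; first by split => // b /hr[].
move=> a b Ba Bb.
apply: row_norm_le => [|j]; first by rewrite mulr_ge0 // invr_ge0.
(* The mean value theorem is scalar, so the estimate is made for one coordinate j at a time. *)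
pose psi (c : 'rV[R]_n) : R := (c - x c *m A) 0 j.
have psiE : psi = (fun c => c 0 j - \sum_k x c 0 k * A k j).
  by apply/funext => c; rewrite /psi !mxE.
have spsi k : sCk k U psi.
  rewrite psiE; apply: sCkB => //; first exact: sCk_coord.
  by apply: sCk_sum => // i _; apply: sCkM => //; exact: sCk_cst.
have Dpsi c X : U c -> 'D_X psi c = \sum_i X 0 i * E (i, j) c.
  move=> Uc; rewrite psiE.
  have d1 := @derive_lincomb R _ n (fun k c => x c 0 k) (A ^~ j) c X
    (fun k => (sxj 1 k).1 c Uc).
  have d2 : is_derive c X (fun c : 'rV[R]_n => c 0 j) (X 0 j).
    by apply: DeriveDef; [exact/diff_derivable/differentiable_coord|
                          exact: derive_coord].
  transitivity (X 0 j - \sum_k 'D_X (fun c => x c 0 k) c * A k j).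
    exact: (@derive_val _ _ _ _ _ _ _ (is_deriveB d2 d1)).
  transitivity ((X *m (1%:M - 'J x c *m A)) 0 j); last by rewrite mxE.
  rewrite mulmxBr mulmx1 2!mxE mulmxA -deriveEjacobian; last exact: dx.
  congr (_ - _); rewrite mxE; apply: eq_bigr => k _.
  by rewrite derive_rowE //; exact: dx.
have inB s : 0 <= s <= 1 -> ball a0 r (b + s *: (a - b)).
  exact: ball_segment.
rewrite [leLHS](_ : _ = `|psi a - psi b|); last by rewrite /psi !mxE.
have [|s s01] := @MVT_line _ _ psi b (a - b) 1 ltr01.
  by move=> s s01; apply/diff_derivable/(spsi 1%N).1; have [] := hr _ (inB s s01).
rewrite scale1r [b + (a - b)]addrC subrK mul1r => ->.
have [Us Es] := hr _ (inB s s01).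
rewrite Dpsi //; apply: (le_trans (ler_norm_sum _ _ _)).
apply: (@le_trans _ _ (\sum_(i < n) `|a - b| * e)).
  apply: ler_sum => i _; rewrite normrM.
  by apply: ler_pM => //; [exact: row_norm_coord|exact/ltW/Es].
rewrite sumr_const card_ord -[leLHS]mulr_natr -mulrA mulrC ler_wpM2r //.
rewrite /e -mulrA ler_piMr ?invr_ge0 // mulrC ler_pdivrMr // mul1r ler_nat.
exact: leqnSn.
Qed.


End InverseFunction.
(** Provides the complete normed structure on row vectors that [closed_ball_fixed_point] asks
    for. *)
HB.instance Definition _ (R : realType) m n := Complete.on 'M[R]_(m, n).

Lemma closed_ball_fixed_point {R : realType} {V : completeNormedModType R}
    (c : V) (rho : R) (T : V -> V) : 0 < rho ->
  (forall a, `|c - a| <= rho -> `|c - T a| <= rho) ->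
  (forall a b, `|c - a| <= rho -> `|c - b| <= rho ->
     `|T a - T b| <= 2^-1 * `|a - b|) ->
  exists2 a, `|c - a| <= rho & a = T a.
Proof.
move=> rho0 mapT lipT.
have cbE a : closed_ball c rho a <-> `|c - a| <= rho by rewrite closed_ballE.
have homoT a : closed_ball c rho a -> closed_ball c rho (T a).
  by rewrite closed_ballE //; exact: mapT.
have ctr : is_contraction (mkfun_fun homoT).
  have h20 : 0 <= 2^-1 :> R by rewrite invr_ge0.
  exists (NngNum h20); split => /=; first by rewrite invf_lt1 // ltr1n.
  by move=> [a b] /= [/cbE ha /cbE hb]; exact: lipT.
have [||a] := banach_fixed_point ctr.
- exact: closed_ball_closed.
- by exists c; apply/cbE; rewrite subrr normr0 ltW.
by move=> /cbE aB aE; exists a.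
Qed.

Section InverseFunctionTheorem.
Context {R : realType} {n : nat}.

(** Simplified Newton iteration: with A the inverse Jacobian at a0, x a = z holds exactly when a is
    fixed by a |-> a - (x a - z) A, which contracts by 1/2 near a0. The contraction estimate also
    makes x injective with a Lipschitz inverse, and this drives the differentiability of y. *)
Lemma inverse_function (U : set 'rV[R]_n) (x : 'rV[R]_n -> 'rV[R]_n) (a0 : 'rV[R]_n) :
  open U -> U a0 -> smooth_on U x -> 'J x a0 \in unitmx ->
  exists (W : set 'rV[R]_n) (y : 'rV[R]_n -> 'rV[R]_n),
  [/\ open W /\ W a0, W `<=` U, open (x @` W), forall a, W a -> y (x a) = a
    & smooth_on (x @` W) y /\ forall a, W a -> 'J x a \in unitmx].
Proof.
move=> oU Ua0 sx uJ.
have sxj k j : sCk k U (fun a => x a 0 j).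
  by move: (sx k) => /(Ck_on_coord _ _ oU); exact.
have dx a : U a -> differentiable x a by move=> Ua; exact: (sx 1).1.
pose A := invmx ('J x a0).
have [r [r0 rU] ctr] := near_contraction oU Ua0 sx (mulmxV uJ).
rewrite -/A in ctr.
(* Half of r, so that the closed ball of radius rho, where fixed points are found, lies in the open
   ball of contraction. *)
pose rho := r / 2.
have rho0 : 0 < rho by rewrite divr_gt0.
(* The displacement of a0 under the iteration for z is (z - x a0) A. Keeping it below rho/2 makes
   the iteration preserve the ball of radius rho; cutting W down to the preimage of V makes the
   image of W exactly V. *)
pose V := [set z | `|(z - x a0) *m A| < rho / 2].
pose W := ball a0 rho `&` x @^-1` V.
have WB : W `<=` ball a0 r.
  by move=> a [Ba _]; apply: le_ball Ba; rewrite /rho ler_piMr ?invf_le1 ?ler1n // ltW.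
have WU : W `<=` U by move=> a /WB/rU.
have cA : continuous (fun z => (z - x a0) *m A).
  by move=> z; apply: (@continuous_comp _ _ _ (fun z => z - x a0) (mulmx^~ A));
    [exact: (cvgB cvg_id (cvg_cst (x a0)))|exact: mulmxr_continuous].
have oV : open V.
  have -> : V = (fun z => (z - x a0) *m A) @^-1` ball 0 (rho / 2).
    by apply/seteqP; split => z; rewrite /V /= -ball_normE /= sub0r normrN.
  by apply: open_comp => [z _|]; [exact: cA|exact: ball_open].
have oW : open W.
  rewrite openE => a [Ba Va].
  have Ua : U a by apply: WU.
  apply: filterI; first by apply: open_nbhs_nbhs; split => //; exact: ball_open.
  by apply: (differentiable_continuous (dx _ Ua)); exact: open_nbhs_nbhs.
have Wa0 : W a0 by split; [exact: ballxx|rewrite /V /= subrr mul0mx normr0 divr_gt0].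
(* a - b is the difference of two values of the contraction plus (x a - x b) A; absorbing the first
   part, at most |a - b| / 2, gives the factor 2. *)
have inv_lip a b : ball a0 r a -> ball a0 r b -> `|a - b| <= 2 * `|(x a - x b) *m A|.
  move=> Ba Bb; have := ctr a b Ba Bb.
  have E : a - b = (a - x a *m A - (b - x b *m A)) + (x a - x b) *m A.
    rewrite mulmxBl; move: (x a *m A) (x b *m A) => p q.
    by apply/rowP => j; rewrite !mxE; ring.
  have := ler_normD (a - x a *m A - (b - x b *m A)) ((x a - x b) *m A).
  rewrite -E; move: `|_| `|_| `|_| => u v w; lra.
have inj_x a b : W a -> W b -> x a = x b -> a = b.
  move=> /WB Ba /WB Bb xab; apply/eqP; rewrite -subr_eq0 -normr_le0.
  by apply: (le_trans (inv_lip _ _ Ba Bb)); rewrite xab subrr mul0mx normr0 mulr0.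
have xW : x @` W = V.
  apply/seteqP; split => [z [a [_ Va] <-] //|z Vz].
  pose T a := a - x a *m A + z *m A.
  have inB a : `|a0 - a| <= rho -> ball a0 r a.
    move=> h; rewrite -ball_normE /= (le_lt_trans h) // /rho.
    by rewrite ltr_pdivrMr // ltr_pMr // ltr1n.
  have TE a b : T a - T b = (a - x a *m A) - (b - x b *m A).
    by rewrite /T opprD addrACA subrr addr0.
  have Tc : `|a0 - T a0| < rho / 2.
    rewrite distrC /T addrAC [_ - a0]addrAC subrr add0r addrC -mulmxBl.
    exact: Vz.
  have hT a : `|a0 - a| <= rho -> `|a0 - T a| < rho.
    move=> ha; rewrite -(subrKA (T a0)) (le_lt_trans (ler_normD _ _)) //.
    rewrite (splitr rho) ltr_leD // TE.
    apply: (le_trans (ctr _ _ (inB a0 _) (inB a ha))); first by rewrite subrr normr0 ltW.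
    by rewrite mulrC ler_wpM2r // invr_ge0.
  have [||a ha aT] := @closed_ball_fixed_point R _ a0 rho T rho0.
  - by move=> a /hT/ltW.
  - by move=> a b /inB Ba /inB Bb; rewrite TE; exact: ctr.
  have xaz : x a = z.
    have : (z - x a) *m A = 0.
      apply: (addrI a); rewrite addr0 mulmxBl [RHS]aT /T.
      move: (x a *m A) (z *m A) => p q.
      by apply/rowP => j; rewrite !mxE; ring.
    move/(congr1 (mulmx^~ ('J x a0))); rewrite -mulmxA mulVmx // mulmx1 mul0mx.
    by move/eqP; rewrite subr_eq0 eq_sym => /eqP.
  exists a => //; split; last by rewrite /= xaz.
  by rewrite -ball_normE /= {1}aT; exact: hT.
pose y z := xget a0 [set a | W a /\ x a = z].
have yV z : V z -> W (y z) /\ x (y z) = z.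
  rewrite -xW => -[a Wa xa]; rewrite /y.
  by have := @xgetPex _ a0 [set a | W a /\ x a = z]; apply; exists a.
have yK a : W a -> y (x a) = a.
  move=> Wa; have Vx : V (x a) by case: Wa.
  have [Wy xy] := yV _ Vx; exact: inj_x.
(* Along a kernel vector v of the Jacobian x would vary by o(t) only, against [inv_lip]. With
   precision 1/(4C) the two estimates give |t v| <= |t v| / 2; t is chosen to bring t v into the
   ball where the remainder estimate holds. *)
have uJW a : W a -> 'J x a \in unitmx.
  move=> Wa; rewrite -row_free_unit -kermx_eq0; apply/rowV0P => v /sub_kermxP vJ.
  have [C C0 hC] := norm_mulmx_le A.
  have e0 : 0 < (4 * C)^-1 by rewrite invr_gt0 mulr_gt0.
  have rem := differentiable_remainder_le (dx a (WU a Wa)) e0.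
  have nW : \forall h \near (0 : 'rV[R]_n), W (h + a).
    have : \forall b \near a, W b by exact: open_nbhs_nbhs.
    rewrite {1}(near_shift 0) /=; apply: filterS => h /=; by rewrite subr0.
  have /nbhs_ballP[d /= d0 hd] : \forall h \near (0 : 'rV[R]_n),
    `|x (h + a) - x a - 'd x a h| <= (4 * C)^-1 * `|h| /\ W (h + a).
    by apply: filterS2 rem nW => h.
  apply/eqP; rewrite -normr_le0 leNgt; apply/negP => v0.
  pose t := d / (2 * `|v|).
  have t0 : 0 < t by rewrite divr_gt0 // mulr_gt0.
  have tv0 : 0 < `|t *: v| by rewrite normrZ mulr_gt0 // normr_gt0 gt_eqF.
  have tvd : ball 0 d (t *: v).
    rewrite -ball_normE /= sub0r normrN normrZ gtr0_norm // /t.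
    by rewrite invfM mulrA divfK ?gt_eqF // ltr_pdivrMr // ltr_pMr // ltr1n.
  have [] := hd _ tvd.
  have -> : 'd x a (t *: v) = 0.
    by rewrite -deriveE ?deriveEjacobian -?scalemxAl ?vJ ?scaler0 //; exact/dx/WU.
  rewrite subr0 => h1 h2.
  have := inv_lip _ _ (WB _ h2) (WB _ Wa); rewrite addrK.
  apply/negP; rewrite -ltNge.
  apply: (@le_lt_trans _ _ (2 * (C * ((4 * C)^-1 * `|t *: v|)))).
    by rewrite ler_pM2l // (le_trans (hC _)) // ler_pM2l.
  move: tv0; move: `|t *: v| => u u0; have CN : C != 0 by rewrite gt_eqF.
  have -> : 2 * (C * ((4 * C)^-1 * u)) = u / 2 by field.
  by rewrite ltr_pdivrMr // ltr_pMr // ltr1n.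
have dy z : V z -> is_diff z y (mulmxr (invmx ('J x (y z)))).
  move=> Vz; have [Wa xa] := yV z Vz; set a := y z in Wa xa *.
  set B := invmx _.
  apply: (@is_diff_remainder _ _ _ _ _ (mulmxr B)); first exact: mulmxr_continuous.
  move=> e e0.
  have [C C0 hC] := norm_mulmx_le A.
  have [D D0 hD] := norm_mulmx_le B.
  (* The remainder of y at h is the remainder of x at k = y (h + z) - a, multiplied by B. Here |k|
     <= 2C |h| by [inv_lip] and B costs a factor D, which fixes the precision required of x. *)
  have e'0 : 0 < e / (D * (2 * C)) by rewrite divr_gt0 // !mulr_gt0.
  have rem := differentiable_remainder_le (dx a (WU a Wa)) e'0.
  have nV : \forall h \near (0 : 'rV[R]_n), V (h + z).
    have : \forall b \near z, V b by exact: open_nbhs_nbhs.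
    rewrite {1}(near_shift 0) /=; apply: filterS => h /=; by rewrite subr0.
  have lip_y h : V (h + z) -> `|y (h + z) - a| <= (2 * C) * `|h|.
    move=> Vh; have [Wh xh] := yV _ Vh.
    apply: (le_trans (inv_lip _ _ (WB _ Wh) (WB _ Wa))).
    by rewrite xh xa addrK -mulrA ler_pM2l.
  have /nbhs_ballP[d /= d0 hd] := rem.
  have nd : \forall h \near (0 : 'rV[R]_n), `|h| < d / (2 * C).
    have dC0 : 0 < d / (2 * C) by rewrite divr_gt0 // mulr_gt0.
    by apply/nbhs_ballP; exists (d / (2 * C)) => // h;
      rewrite -ball_normE /= sub0r normrN.
  apply: filterS2 nV nd => h Vh hh.
  have [Wh xh] := yV _ Vh; set k := y (h + z) - a.
  have kh : `|k| <= (2 * C) * `|h| by exact: lip_y.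
  have kd : ball 0 d k.
    rewrite -ball_normE /= sub0r normrN (le_lt_trans kh) //.
    by rewrite mulrC -ltr_pdivlMr // mulr_gt0.
  have := hd _ kd; rewrite /= [k + a]subrK xh xa addrK.
  rewrite -deriveE ?deriveEjacobian; try exact/dx/WU.
  move=> h1.
  have -> : y (h + z) - y z - h *m B = - ((h - k *m 'J x a) *m B).
    by rewrite mulmxBl -mulmxA mulmxV ?uJW // mulmx1 opprB.
  rewrite normrN (le_trans (hD _)) //.
  apply: (@le_trans _ _ (D * (e / (D * (2 * C)) * (2 * C * `|h|)))).
    by rewrite ler_pM2l // (le_trans h1) // ler_pM2l.
  have DN : D != 0 by rewrite gt_eqF.
  have CN : C != 0 by rewrite gt_eqF.
  move: `|h| => u; rewrite le_eqVlt; apply/orP; left; apply/eqP.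
  by field; rewrite DN CN.
have Dy z X : V z -> 'D_X y z = X *m invmx ('J x (y z)).
  by move=> Vz; have [d E] := dy z Vz; rewrite deriveE // E.
(* Bootstrapping: the derivative of y is the inverse Jacobian of x composed with y, so y gains one
   order at a time. *)
have sy k : forall j, sCk k V (fun z => y z 0 j).
  have dyj j z : V z -> differentiable (fun z => y z 0 j) z.
    by move=> Vz; have [/differentiable_rowP] := dy z Vz; exact.
  elim: k => [|k IH] j; first by move=> z Vz; exact/differentiable_continuous/dyj.
  split; first exact: dyj.
  move=> X.
  have h : sCk k V (fun z => \sum_i X 0 i * invmx ('J x (y z)) i j).
    apply: sCk_sum => // i _; apply: sCkM => //; first exact: sCk_cst.
    apply: (@sCk_comp _ _ _ _ V W (fun a => invmx ('J x a) i j) y) => //.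
      by move=> z /yV[].
    apply: sCk_invmx => // u v; apply: (sCk_sub WU).
    exact: (sCk_jacobian oU sx).
  apply: sCk_eq h => // z Vz.
  by rewrite -derive_rowE ?Dy ?mxE //; have [] := dy z Vz.
exists W, y; rewrite xW; split => //; split => // k.
by apply/Ck_on_coord.
Qed.

End InverseFunctionTheorem.
(** * Flat immersions with nondegenerate normal bundle *)

Section LorentzCalculus.
Context {R : realType} {N : nat}.
Implicit Types x y z : 'rV[R]_N.

Definition lsign (j : 'I_N) : R := if j.+1 == N then -1 else 1.

Lemma lformE x y : lform x y = \sum_j lsign j * (x 0 j * y 0 j).
Proof.
rewrite /lform /lorentz_mx mul_mx_diag mxE; apply: eq_bigr => j _.
by rewrite !mxE /lsign mulrAC mulrC.
Qed.

Lemma lformC x y : lform x y = lform y x.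
Proof. by rewrite !lformE; apply: eq_bigr => j _; rewrite (mulrC (x 0 j)). Qed.

Lemma lformDl x y z : lform (x + y) z = lform x z + lform y z.
Proof. by rewrite /lform !mulmxDl mxE. Qed.

Lemma lformZl c x z : lform (c *: x) z = c * lform x z.
Proof. by rewrite /lform -!scalemxAl mxE. Qed.

Lemma lformDr x y z : lform z (x + y) = lform z x + lform z y.
Proof. by rewrite !(lformC z) lformDl. Qed.

Lemma lformZr c x z : lform z (c *: x) = c * lform z x.
Proof. by rewrite !(lformC z) lformZl. Qed.

Lemma lformNl x z : lform (- x) z = - lform x z.
Proof. by rewrite -scaleN1r lformZl mulN1r. Qed.

Lemma lformNr x z : lform z (- x) = - lform z x.
Proof. by rewrite !(lformC z) lformNl. Qed.

Lemma lformBl x y z : lform (x - y) z = lform x z - lform y z.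
Proof. by rewrite lformDl lformNl. Qed.

Lemma lformBr x y z : lform z (x - y) = lform z x - lform z y.
Proof. by rewrite lformDr lformNr. Qed.

Lemma lform0l z : lform 0 z = 0.
Proof. by rewrite /lform !mul0mx mxE. Qed.

Lemma lform_suml (I : Type) (r : seq I) (P : pred I) (F : I -> 'rV[R]_N) z :
  lform (\sum_(i <- r | P i) F i) z = \sum_(i <- r | P i) lform (F i) z.
Proof.
elim: r => [|i r IH]; first by rewrite !big_nil lform0l.
by rewrite !big_cons; case: ifP; rewrite ?lformDl IH.
Qed.

Lemma lform_sumr (I : Type) (r : seq I) (P : pred I) (F : I -> 'rV[R]_N) z :
  lform z (\sum_(i <- r | P i) F i) = \sum_(i <- r | P i) lform z (F i).
Proof. by rewrite lformC lform_suml; apply: eq_bigr => i _; rewrite lformC. Qed.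

Lemma lform_nondegenerate x : (forall y, lform x y = 0) -> x = 0.
Proof.
move=> h; apply/rowP => j; rewrite mxE.
have := h (delta_mx 0 j); rewrite lformE (bigD1 j) //= big1 => [|i ij].
  rewrite mxE !eqxx mulr1 addr0 /lsign; case: ifP => _.
    by rewrite mulN1r => /eqP; rewrite oppr_eq0 => /eqP.
  by rewrite mul1r.
by rewrite mxE eqxx (negbTE ij) mulr0 mulr0.
Qed.

Section Derivatives.
Context {m : nat}.
Implicit Types (U : set 'rV[R]_m) (f g : 'rV[R]_m -> 'rV[R]_N).

Lemma sCk_lform k U f g : open U -> Ck_on k U f -> Ck_on k U g ->
  sCk k U (fun a => lform (f a) (g a)).
Proof.
move=> oU /(Ck_on_coord _ _ oU) hf /(Ck_on_coord _ _ oU) hg.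
have h : sCk k U (fun a => \sum_j lsign j * (f a 0 j * g a 0 j)).
  by apply: sCk_sum => // j _; apply: sCkM => //; [exact: sCk_cst|exact: sCkM].
by apply: sCk_eq h => // a _; rewrite lformE.
Qed.

Lemma is_derive_lform f g a X : differentiable f a -> differentiable g a ->
  is_derive a X (fun b => lform (f b) (g b))
    (lform ('D_X f a) (g a) + lform (f a) ('D_X g a)).
Proof.
move=> df dg.
have /differentiable_rowP dfj := df; have /differentiable_rowP dgj := dg.
have d j : is_derive a X (fun b => lsign j * (f b 0 j * g b 0 j))
   (lsign j * ('D_X f a 0 j * g a 0 j + f a 0 j * 'D_X g a 0 j)).
  rewrite !derive_rowE //.
  have h1 := derivableP (diff_derivable (v := X) (dfj j)).
  have h2 := derivableP (diff_derivable (v := X) (dgj j)).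
  apply: is_deriveZ; apply: is_derive_eq (is_deriveM h1 h2) _.
  by rewrite /GRing.scale /= addrC mulrC.
have := @is_derive_sum R _ R N _ a X _ d.
under [X in is_derive _ _ _ X -> _]eq_bigr do rewrite mulrDr.
rewrite big_split /= -!lformE fct_sumE => h.
by under eq_fun do rewrite lformE.
Qed.

Lemma derive_lform f g a X : differentiable f a -> differentiable g a ->
  'D_X (fun b => lform (f b) (g b)) a =
  lform ('D_X f a) (g a) + lform (f a) ('D_X g a).
Proof. by move=> df dg; have [] := is_derive_lform X df dg. Qed.

End Derivatives.
End LorentzCalculus.

Section SmoothFields.
Context {R : realType} {m n : nat}.
Implicit Types (U : set 'rV[R]_m) (f g : 'rV[R]_m -> 'rV[R]_n).

Lemma smooth_differentiable U f a : smooth_on U f -> U a -> differentiable f a.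
Proof. by move=> sf; exact: (sf 1).1. Qed.

Lemma smooth_derive U f X : smooth_on U f -> smooth_on U (fun a => 'D_X f a).
Proof. by move=> sf k; exact: (sf k.+1).2. Qed.

Lemma smooth_coordP U f : open U ->
  smooth_on U f <-> forall k j, sCk k U (fun a => f a 0 j).
Proof.
move=> oU; split=> [sf k j|h k]; last by apply/Ck_on_coord.
by have /(Ck_on_coord _ _ oU) := sf k; exact.
Qed.

Lemma smooth_derive_swap U f a X Y : open U -> smooth_on U f -> U a ->
  'D_X (fun b => 'D_Y f b) a = 'D_Y (fun b => 'D_X f b) a.
Proof.
move=> oU sf Ua; apply/rowP => j.
have d Z : differentiable (fun b => 'D_Z f b) a.
  exact: (smooth_differentiable (smooth_derive Z sf) Ua).
have E1 := derive_rowE X j (d Y).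
have E2 := derive_rowE Y j (d X).
apply: (etrans E1); apply/esym; apply: (etrans E2); apply/esym.
have E Z W : 'D_W (fun b => 'D_Z f b 0 j) a = 'D_W (fun b => 'D_Z (fun c => f c 0 j) b) a.
  apply: near_eq_derive; apply: (open_eq_near oU _ Ua) => b Ub.
  by rewrite (derive_rowE _ _ (smooth_differentiable sf Ub)).
have sfj : sCk 2 U (fun c => f c 0 j) by move/(smooth_coordP _ oU) : sf; exact.
exact: (etrans (E Y X) (etrans (derive_swap X Y oU Ua sfj) (esym (E X Y)))).
Qed.

Lemma derive_dirZ f a c X : differentiable f a -> 'D_(c *: X) f a = c *: 'D_X f a.
Proof. by move=> df; rewrite !deriveE // linearZ. Qed.

Lemma derive_dir_sum (I : Type) (r : seq I) (P : pred I) (F : I -> 'rV[R]_m) f a :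
  differentiable f a ->
  'D_(\sum_(i <- r | P i) F i) f a = \sum_(i <- r | P i) 'D_(F i) f a.
Proof.
move=> df; rewrite deriveE // linear_sum.
by apply: eq_bigr => i _; rewrite deriveE.
Qed.

End SmoothFields.

(** * Shape operators and nondegeneracy at a point *)

Section Pointwise.
Context {R : realType} {n N : nat}.
Variables (U : set 'rV[R]_n) (f : 'rV[R]_n -> 'rV[R]_N).
Hypothesis oU : open U.
Hypothesis sf : smooth_on U f.
Local Notation D2 X Y a := ('D_X (fun b => 'D_Y f b) a).

Let df a : U a -> differentiable f a.
Proof. exact: smooth_differentiable. Qed.

Let dDf Y a : U a -> differentiable (fun b => 'D_Y f b) a.
Proof. by move=> Ua; exact: (smooth_differentiable (smooth_derive Y sf) Ua). Qed.

Lemma mulmx_tr_delta (G : 'M[R]_n) i j :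
  ((delta_mx 0 i : 'rV[R]_n) *m G *m (delta_mx 0 j : 'rV[R]_n)^T) 0 0 = G i j.
Proof. by rewrite -rowE trmx_delta -colE !mxE. Qed.

Lemma first_formE a : U a -> first_form f a = 'J f a *m lorentz_mx *m ('J f a)^T.
Proof.
move=> Ua; apply/matrixP => i j; rewrite mxE -[RHS]mulmx_tr_delta /lform.
rewrite (deriveEjacobian (basis_vec i) (df Ua)) (deriveEjacobian (basis_vec j) (df Ua)).
by rewrite trmx_mul !mulmxA.
Qed.

Lemma first_form_lform a X Y : U a ->
  (X *m first_form f a *m Y^T) 0 0 = lform ('D_X f a) ('D_Y f a).
Proof.
move=> Ua; rewrite first_formE // /lform.
rewrite (deriveEjacobian X (df Ua)) (deriveEjacobian Y (df Ua)).
by rewrite trmx_mul !mulmxA.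
Qed.

Lemma first_form_unit a : pos_def_at f a -> first_form f a \in unitmx.
Proof.
move=> pd; rewrite -row_free_unit -kermx_eq0; apply/rowV0P => X /sub_kermxP XG.
apply/eqP/negP => /negP /pd; rewrite XG mul0mx mxE ltxx.
by [].
Qed.

Lemma derive2C a X Y : U a -> D2 X Y a = D2 Y X a.
Proof. exact: smooth_derive_swap. Qed.

Lemma derive2_sumr a X (I : Type) (r : seq I) (F : I -> 'rV[R]_n) : U a ->
  D2 X (\sum_(i <- r) F i) a = \sum_(i <- r) D2 X (F i) a.
Proof.
move=> Ua; apply: (etrans (derive2C _ _ Ua)).
apply: (etrans (derive_dir_sum _ _ _ (dDf X Ua))).
by apply: eq_bigr => i _; exact: derive2C.
Qed.

Lemma derive2Zr a X c Y : U a -> D2 X (c *: Y) a = c *: D2 X Y a.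
Proof.
move=> Ua; apply: (etrans (derive2C _ _ Ua)).
apply: (etrans (derive_dirZ _ _ (dDf X Ua))).
exact: (congr1 ( *:%R c) (derive2C _ _ Ua)).
Qed.

(* Differentiate lform ('D_Y f) xi = 0. *)
Lemma normal_field_weingarten a xi X Y : U a -> normal_field_near f a xi ->
  lform ('D_Y f a) ('D_X xi a) = - lform (D2 X Y a) (xi a).
Proof.
move=> Ua [[U' [oU' U'a sxi]] nxi].
have dxi := smooth_differentiable sxi U'a.
have := derive_lform X (dDf Y Ua) dxi.
rewrite (near_eq_derive (g := fun=> 0)) ?derive_cst; last first.
  by apply: filterS nxi => b; exact.
by move/esym/eqP; rewrite addrC addr_eq0 => /eqP.
Qed.

Lemma shape_opE a xi X Y : U a -> first_form f a \in unitmx ->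
  normal_field_near f a xi ->
  (X *m shape_op f xi a *m first_form f a *m Y^T) 0 0 = lform (D2 X Y a) (xi a).
Proof.
move=> Ua ug nxi.
have [[U' [oU' U'a sxi]] _] := nxi.
have dxi := smooth_differentiable sxi U'a.
rewrite /shape_op /tan_mx mulmxN !mulNmx mxE !mulmxA mulmxKV // -!mulmxA -trmx_mul.
rewrite !mulmxA -(deriveEjacobian X dxi) -(deriveEjacobian Y (df Ua)).
by rewrite -/(lform _ _) lformC (normal_field_weingarten _ _ Ua nxi) opprK.
Qed.

(** The shape operator as a function of the normal vector alone, without a field through it: the
    second fundamental form paired with w, with an index raised by the metric. Being linear in w on
    the whole ambient space, it is accessible to a dimension count. *)
Definition shape_mx a (w : 'rV[R]_N) : 'M[R]_n :=
  (\matrix_(i, j) lform (D2 (basis_vec i) (basis_vec j) a) w) *m invmx (first_form f a).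

Fact shape_mx_linear a : linear (shape_mx a).
Proof.
move=> k w w'; rewrite /shape_mx scalemxAl -mulmxDl; congr (_ *m _).
by apply/matrixP => i j; rewrite !mxE lformDr lformZr.
Qed.

Lemma shape_op_mx a xi : U a -> first_form f a \in unitmx ->
  normal_field_near f a xi -> shape_op f xi a = shape_mx a (xi a).
Proof.
move=> Ua ug nxi; rewrite /shape_mx.
apply: (can_inj (mulmxK ug)); rewrite mulmxKV //.
apply/matrixP => i j; rewrite -[LHS]mulmx_tr_delta mulmxA shape_opE // mxE.
by [].
Qed.

(** The normal space [K] is the kernel of a map onto R^n, so its dimension is at most N - n. Its
    image under [Phi] contains all shape operators, a space of dimension N - n by nondegeneracy.
    Hence [Phi] is injective on [K] and its image consists of shape operators of normal fields. *)
Lemma normal_fields_extend a : U a -> pos_def_at f a -> (n <= N)%N ->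
  nondegenerate_at f a ->
  (forall w, normal_at f a w -> exists2 xi, normal_field_near f a xi & xi a = w) /\
  (forall w, normal_at f a w -> (forall X Y, lform (D2 X Y a) w = 0) -> w = 0).
Proof.
move=> Ua pd nN [V dimV VE].
have ug := first_form_unit pd.
pose G := first_form f a.
pose tau := linfun (mulmxr (lorentz_mx *m ('J f a)^T) : {linear 'rV[R]_N -> 'rV[R]_n}).
pose K := lker tau.
have KP w : w \in K -> normal_at f a w.
  rewrite memv_ker lfunE /= => /eqP h X.
  rewrite lformC /lform (deriveEjacobian X (df Ua)) trmx_mul mulmxA.
  by rewrite -[w *m _ *m _]mulmxA h mul0mx mxE.
have PK w : normal_at f a w -> w \in K.
  move=> h; rewrite memv_ker lfunE /=; apply/eqP/rowP => j.
  have := h (basis_vec j); rewrite lformC /lform (deriveEjacobian _ (df Ua)) trmx_mul mulmxA.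
  rewrite /basis_vec trmx_delta !mulmxA; move: (w *m _ *m _) => u.
  by rewrite -colE mxE => ->; rewrite mxE.
have dimK : (\dim K <= N - n)%N.
  have := limg_ker_dim tau fullv; rewrite capfv -/K.
  have -> : (tau @: fullv)%VS = fullv.
    apply/eqP; rewrite eqEsubv subvf; apply/subvP => u _.
    (* Surjectivity of [tau]: the first fundamental form is the Jacobian followed by [tau], and it
       is invertible. *)
    have -> : u = tau (u *m invmx G *m 'J f a).
      transitivity (u *m invmx G *m ('J f a *m lorentz_mx *m ('J f a)^T)).
        by rewrite -first_formE // mulmxKV.
      by rewrite lfunE /= !mulmxA.
    by rewrite memv_img ?memvf.
  rewrite !dimvf /dim /= !mul1n => E.
  by move: (\dim K) E => d <-; rewrite addnK.
pose lin_shape : {linear 'rV[R]_N -> 'M[R]_n} :=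
  HB.pack (shape_mx a) (GRing.isLinear.Build _ _ _ _ _ (shape_mx_linear a)).
pose Phi := linfun lin_shape.
have VsubPhi : (V <= Phi @: K)%VS.
  apply/subvP => M MV.
  have : shape_ops f a M by rewrite VE.
  case=> xi nxi <-; rewrite shape_op_mx //.
  have -> : shape_mx a (xi a) = Phi (xi a) by rewrite lfunE.
  by apply: memv_img; apply: PK; have [_ /nbhs_singleton] := nxi.
have dimKV := limg_ker_dim Phi K.
have capK : (K :&: lker Phi)%VS = 0%VS.
  apply/eqP; rewrite -dimv_eq0.
  have := dimvS VsubPhi; rewrite dimV => h.
  have : (\dim (K :&: lker Phi) + (N - n) <= 0 + (N - n))%N.
    by rewrite add0n (leq_trans _ dimK) // -dimKV leq_add2l.
  by rewrite leq_add2r leqn0.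
have PhiV : (Phi @: K)%VS = V.
  apply/esym/eqP; rewrite eqEdim VsubPhi dimV.
  by move: dimKV; rewrite capK dimv0 add0n => ->.
have injK w : w \in K -> Phi w = 0 -> w = 0.
  move=> wK Pw; have : w \in (K :&: lker Phi)%VS by rewrite memv_cap wK memv_ker Pw eqxx.
  by rewrite capK memv0 => /eqP.
split=> w /PK wK.
  (* No extension of w is constructed. Some normal field has shape operator [Phi w], and injectivity
     forces its value at a to be w. *)
  have : shape_ops f a (Phi w) by rewrite VE /= -PhiV memv_img.
  case=> xi nxi; rewrite shape_op_mx // => E.
  exists xi => //; apply/eqP; rewrite -subr_eq0; apply/eqP/injK.
    by rewrite memvB //; apply: PK; have [_ /nbhs_singleton] := nxi.
  by rewrite linearB /= -E lfunE subrr.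
move=> h; apply: injK => //; rewrite lfunE /= /shape_mx.
rewrite (_ : \matrix_(i, j) _ = 0) ?mul0mx //.
by apply/matrixP => i j; rewrite !mxE h.
Qed.

End Pointwise.

(** * Christoffel symbols and the Gauss equation of a flat metric *)

Section Gauss.
Context {R : realType} {n N : nat}.
Variables (U : set 'rV[R]_n) (f : 'rV[R]_n -> 'rV[R]_N).
Hypothesis oU : open U.
Hypothesis sf : smooth_on U f.
Hypothesis ug : forall a, U a -> first_form f a \in unitmx.
Local Notation D2 X Y a := ('D_X (fun b => 'D_Y f b) a).
Local Notation g := (first_form f).
Local Notation e := (@basis_vec R n).
Local Notation Gamma := (christoffel (first_form f)).

Let df a : U a -> differentiable f a.
Proof. exact: smooth_differentiable. Qed.

Let dDf Y a : U a -> differentiable (fun b => 'D_Y f b) a.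
Proof. by move=> Ua; exact: (smooth_differentiable (smooth_derive Y sf) Ua). Qed.

Lemma sCk_first_form k i j : sCk k U (fun a => g a i j).
Proof.
have h : sCk k U (fun a => lform ('D_(e i) f a) ('D_(e j) f a)).
  by apply: sCk_lform => //; exact: smooth_derive.
by apply: sCk_eq h => // a _; rewrite mxE.
Qed.

Lemma first_form_sym a i j : g a i j = g a j i.
Proof. rewrite !mxE; exact: lformC. Qed.

Lemma derive_first_form i j k a : U a ->
  'D_(e k) (fun b => g b i j) a =
  lform (D2 (e k) (e i) a) ('D_(e j) f a) + lform ('D_(e i) f a) (D2 (e k) (e j) a).
Proof.
move=> Ua; rewrite -(derive_lform (e k) (dDf (e i) Ua) (dDf (e j) Ua)).
by congr ('D_(e k) _ a); apply/funext => b; rewrite mxE.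
Qed.

(** The Christoffel symbols of the first kind, as an abstract array of which only the symmetry in i
    and j is retained. *)
Lemma christoffel1 a : U a -> exists T : 'I_n -> 'I_n -> 'I_n -> R,
  (forall i j m, T i j m = lform (D2 (e i) (e j) a) ('D_(e m) f a)) /\
  (forall i j m, T i j m = T j i m).
Proof.
move=> Ua; exists (fun i j m => lform (D2 (e i) (e j) a) ('D_(e m) f a)).
split=> [i j m //|i j m].
exact: (congr1 (lform^~ ('D_(e m) f a)) (smooth_derive_swap (e i) (e j) oU sf Ua)).
Qed.

(** For an induced metric, each derivative of g is a sum of two symbols of the first kind; in the
    Koszul combination four of the six cancel and the other two coincide, which absorbs the factor
    1/2. *)
Lemma christoffel_lform i j m a : U a ->
  \sum_l Gamma i j l a * g a l m = lform (D2 (e i) (e j) a) ('D_(e m) f a).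
Proof.
move=> Ua; rewrite /christoffel.
pose S l := 'D_(e i) (fun b => g b j l) a + 'D_(e j) (fun b => g b i l) a -
  'D_(e l) (fun b => g b i j) a.
transitivity (2^-1 * \sum_q S q * (g a *m invmx (g a)) m q).
  under eq_bigr do rewrite -mulrA mulr_suml.
  rewrite -mulr_sumr exchange_big /=; congr (_ * _); apply: eq_bigr => q _.
  rewrite mxE mulr_sumr; apply: eq_bigr => l _; rewrite -/(S q) first_form_sym.
  by ring.
rewrite mulmxV ?ug // (bigD1 m) //= big1 => [|q qm]; last first.
  by rewrite mxE eq_sym (negbTE qm) mulr0.
rewrite mxE eqxx mulr1 addr0 /S.
have [T [TE TC]] := christoffel1 Ua.
have dgE u v w : 'D_(e w) (fun b => g b u v) a = T w u v + T w v u.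
  apply: (etrans (derive_first_form u v w Ua)).
  by rewrite (TE w u v) (TE w v u); congr (_ + _); exact: lformC.
rewrite -(TE i j m) !dgE (TC j i) (TC m i) (TC m j).
by clear TE TC dgE S; field.
Qed.

Lemma sCk_christoffel k i j l : sCk k U (Gamma i j l).
Proof.
apply: sCkM => //; first exact: sCk_cst.
apply: sCk_sum => // q _; apply: sCkM => //.
  by apply: sCk_invmx => // u v; exact: sCk_first_form.
by apply: sCkB => //; [apply: sCkD => //|]; exact: (sCk_first_form k.+1 _ _).2.
Qed.

Definition second_form X Y a : 'rV[R]_N := normal_part f a (D2 X Y a).

Lemma lform_normal_part a w X : U a -> lform (normal_part f a w) ('D_X f a) = 0.
Proof.
move=> Ua.
have E Z : lform (Z *m 'J f a) ('D_X f a) = (Z *m g a *m X^T) 0 0.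
  by rewrite -(deriveEjacobian Z (df Ua)) (first_form_lform sf).
rewrite /normal_part lformBl E /tan_mx !mulmxA mulmxKV ?ug //.
by rewrite /lform (deriveEjacobian X (df Ua)) trmx_mul !mulmxA subrr.
Qed.

Lemma normal_part_normal a w : U a -> normal_at f a (normal_part f a w).
Proof. by move=> Ua X; rewrite lformC lform_normal_part. Qed.

Lemma lform_tangent_part a u w : U a -> normal_at f a u ->
  lform (normal_part f a w) u = lform w u.
Proof.
move=> Ua nu; rewrite /normal_part lformBl -(deriveEjacobian _ (df Ua)).
by rewrite nu subr0.
Qed.

Lemma second_form_christoffel i j a : U a ->
  second_form (e i) (e j) a = D2 (e i) (e j) a - \sum_l Gamma i j l a *: 'D_(e l) f a.
Proof.
move=> Ua; rewrite /second_form /normal_part; congr (_ - _).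
pose c := \row_l Gamma i j l a.
have -> : D2 (e i) (e j) a *m tan_mx f a = c.
  apply: (can_inj (mulmxK (ug Ua))); rewrite /tan_mx !mulmxA mulmxKV ?ug //.
  apply/rowP => m; rewrite [RHS]mxE.
  under [RHS]eq_bigr do rewrite mxE.
  rewrite christoffel_lform // /lform (deriveEjacobian _ (df Ua)) trmx_mul.
  rewrite /basis_vec trmx_delta !mulmxA; move: (_ *m ('J f a)^T) => u.
  by rewrite -colE mxE.
rewrite -(deriveEjacobian c (df Ua)) {1}(row_sum_delta c) derive_dir_sum; last exact: df.
by apply: eq_bigr => l _; rewrite derive_dirZ ?mxE //; exact: df.
Qed.

(** Differentiates [christoffel_lform] in direction e_i. The left side produces a third derivative
    of f and a product of second derivatives; removing the tangential components from that product,
    by the Gauss formula [second_form_christoffel], turns it into a product of second fundamental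
    forms. *)
Lemma gauss_basis a i j k m : U a ->
  lform (second_form (e j) (e k) a) (second_form (e i) (e m) a) =
  \sum_l ('D_(e i) (Gamma j k l) a + \sum_p Gamma j k p a * Gamma i p l a) * g a l m
  - lform ('D_(e i) (fun b => D2 (e j) (e k) b) a) ('D_(e m) f a).
Proof.
move=> Ua.
have dD2 : differentiable (fun b => D2 (e j) (e k) b) a.
  exact: (smooth_differentiable (smooth_derive (e j) (smooth_derive (e k) sf)) Ua).
have dG l : differentiable (Gamma j k l) a by exact: (sCk_christoffel 1 j k l).1.
have dg l : differentiable (fun b => g b l m) a by exact: (sCk_first_form 1 l m).1.
have E1 := derive_lform (e i) dD2 (dDf (e m) Ua).
have E2 : 'D_(e i) (fun b => \sum_l Gamma j k l b * g b l m) a =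
   \sum_l ('D_(e i) (Gamma j k l) a * g a l m + Gamma j k l a * 'D_(e i) (fun b => g b l m) a).
  have d l : is_derive a (e i) (fun b => Gamma j k l b * g b l m)
    ('D_(e i) (Gamma j k l) a * g a l m + Gamma j k l a * 'D_(e i) (fun b => g b l m) a).
    have h1 := derivableP (diff_derivable (v := e i) (dG l)).
    have h2 := derivableP (diff_derivable (v := e i) (dg l)).
    apply: is_derive_eq (is_deriveM h1 h2) _.
    by rewrite /GRing.scale /= addrC mulrC.
  have := @is_derive_sum R _ R n _ a (e i) _ d; rewrite fct_sumE => h.
  exact: derive_val.
have E3 : 'D_(e i) (fun b => lform (D2 (e j) (e k) b) ('D_(e m) f b)) a =
   'D_(e i) (fun b => \sum_l Gamma j k l b * g b l m) a.
  apply: near_eq_derive; apply: (open_eq_near oU _ Ua) => b Ub.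
  by rewrite christoffel_lform.
rewrite {}E1 {}E2 in E3.
have E4 : lform (second_form (e j) (e k) a) (second_form (e i) (e m) a) =
  lform (second_form (e j) (e k) a) (D2 (e i) (e m) a).
  exact: (etrans (lformC _ _) (etrans (lform_tangent_part (D2 (e i) (e m) a) Ua
    (normal_part_normal _ Ua)) (lformC _ _))).
apply: (etrans E4) => {E4}.
pose Q l := lform ('D_(e l) f a) (D2 (e i) (e m) a).
have E5 : lform (second_form (e j) (e k) a) (D2 (e i) (e m) a) =
    lform (D2 (e j) (e k) a) (D2 (e i) (e m) a) - \sum_l Gamma j k l a * Q l.
  apply: (etrans (congr1 (lform^~ (D2 (e i) (e m) a)) (second_form_christoffel j k Ua))).
  apply: (etrans (lformBl _ _ _)); congr (_ - _); apply: (etrans (lform_suml _ _ _ _)).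
  by apply: eq_bigr => l _; exact: lformZl.
apply: (etrans E5) => {E5}.
have E6 l : 'D_(e i) (fun b => g b l m) a = \sum_p Gamma i l p a * g a p m + Q l.
  by rewrite christoffel_lform //; exact: derive_first_form.
(* Here t stands for the term with the third derivative and A for the product of second derivatives;
   what remains is a rearrangement of finite sums. *)
have final (t A : R) :
    t + A = \sum_l ('D_(e i) (Gamma j k l) a * g a l m +
                    Gamma j k l a * 'D_(e i) (fun b => g b l m) a) ->
    A - \sum_l Gamma j k l a * Q l =
    \sum_l ('D_(e i) (Gamma j k l) a + \sum_p Gamma j k p a * Gamma i p l a) * g a l m - t.
  move=> tA; apply/eqP; rewrite subr_eq addrAC eq_sym subr_eq addrC [A + t]addrC tA.
  apply/eqP; under [RHS]eq_bigr do rewrite E6 mulrDr addrA.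
  rewrite big_split /= addrC; congr (_ + _).
  under [LHS]eq_bigr do rewrite mulrDl.
  rewrite !big_split /=; congr (_ + _).
  under [LHS]eq_bigr do rewrite mulr_suml.
  rewrite exchange_big /=; apply: eq_bigr => p _.
  by rewrite mulr_sumr; apply: eq_bigr => l _; rewrite mulrA.
exact: final E3.
Qed.

(** Two instances of [gauss_basis] with i and j exchanged are subtracted: the third derivatives
    cancel by symmetry, and the Christoffel terms combine into coefficients of the curvature tensor,
    which vanish. *)
Lemma flat_gauss_basis a i j k m : U a -> flat_at f a ->
  lform (second_form (e j) (e k) a) (second_form (e i) (e m) a) =
  lform (second_form (e i) (e k) a) (second_form (e j) (e m) a).
Proof.
move=> Ua [_ flat].
have E : \sum_l ('D_(e i) (Gamma j k l) a + \sum_p Gamma j k p a * Gamma i p l a) * g a l m =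
    \sum_l ('D_(e j) (Gamma i k l) a + \sum_p Gamma i k p a * Gamma j p l a) * g a l m.
  apply: eq_bigr => l _; congr (_ * _); apply/eqP; rewrite -subr_eq0; apply/eqP.
  rewrite -[RHS](flat i j k l) /riemann sumrB.
  move: ('D_(e i) _ _) ('D_(e j) _ _) (\sum_p _) (\sum_p _) => p q s t; ring.
have sw : 'D_(e i) (fun b => D2 (e j) (e k) b) a = 'D_(e j) (fun b => D2 (e i) (e k) b) a.
  exact: (smooth_derive_swap (e i) (e j) oU (smooth_derive (e k) sf) Ua).
have := congr2 (fun x y : R => x - y) E (congr1 (lform^~ ('D_(e m) f a)) sw).
move=> /= E'.
exact: (etrans (gauss_basis i j k m Ua) (etrans E' (esym (gauss_basis j i k m Ua)))).
Qed.


End Gauss.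
(** Both sides are linear in each of the four arguments, so the relation on basis vectors suffices;
    b and B are kept abstract because nothing but bilinearity matters. *)
Lemma gauss_multilinear {R : realType} {n N : nat} (b : 'I_n -> 'I_n -> 'rV[R]_N)
    (B : 'rV[R]_n -> 'rV[R]_n -> 'rV[R]_N) :
  (forall X Y, B X Y = \sum_i \sum_j (X 0 i * Y 0 j) *: b i j) ->
  (forall i j k m, lform (b j k) (b i m) = lform (b i k) (b j m)) ->
  forall X Y Z W, lform (B Y Z) (B X W) = lform (B X Z) (B Y W).
Proof.
move=> BE bb.
have E X Y Z W : lform (B Y Z) (B X W) = \sum_j \sum_i \sum_k \sum_m
   Y 0 j * Z 0 k * (X 0 i * W 0 m) * lform (b j k) (b i m).
  rewrite !BE lform_suml; apply: eq_bigr => j _; rewrite lform_suml.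
  under eq_bigr do rewrite lform_sumr.
  rewrite exchange_big /=; apply: eq_bigr => i _; apply: eq_bigr => k _.
  rewrite lform_sumr; apply: eq_bigr => m _.
  by rewrite lformZl lformZr mulrA.
move=> X Y Z W; rewrite E [RHS]E exchange_big /=; apply: eq_bigr => i _.
apply: eq_bigr => j _; apply: eq_bigr => k _; apply: eq_bigr => m _.
by rewrite (bb i j k m); congr (_ * _); ring.
Qed.

(** * The second fundamental form as a bilinear map *)

Section SecondForm.
Context {R : realType} {n N : nat}.
Variables (U : set 'rV[R]_n) (f : 'rV[R]_n -> 'rV[R]_N).
Hypothesis oU : open U.
Hypothesis sf : smooth_on U f.
Hypothesis ug : forall a, U a -> first_form f a \in unitmx.
Local Notation D2 X Y a := ('D_X (fun b => 'D_Y f b) a).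
Local Notation e := (@basis_vec R n).

Lemma second_form_normal X Y a : U a -> normal_at f a (second_form f X Y a).
Proof. exact: normal_part_normal. Qed.

Lemma second_formC X Y a : U a -> second_form f X Y a = second_form f Y X a.
Proof. by move=> Ua; exact: (congr1 (normal_part f a) (smooth_derive_swap X Y oU sf Ua)). Qed.

Lemma lform_second_form X Y a w : U a -> normal_at f a w ->
  lform (second_form f X Y a) w = lform (D2 X Y a) w.
Proof. by move=> Ua nw; exact: (lform_tangent_part sf). Qed.

Lemma normal_part_sum (I : Type) (r : seq I) (c : I -> R) (w : I -> 'rV[R]_N) a :
  normal_part f a (\sum_(i <- r) c i *: w i) = \sum_(i <- r) c i *: normal_part f a (w i).
Proof.
rewrite /normal_part !mulmx_suml -sumrB; apply: eq_bigr => i _.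
by rewrite scalerBr -!scalemxAl.
Qed.

Lemma derive2_expand X Y a : U a ->
  D2 X Y a = \sum_i X 0 i *: \sum_j Y 0 j *: D2 (e i) (e j) a.
Proof.
move=> Ua.
have d : differentiable (fun b => 'D_Y f b) a.
  exact: (smooth_differentiable (smooth_derive Y sf) Ua).
have E i : D2 (e i) Y a = \sum_j Y 0 j *: D2 (e i) (e j) a.
  have E1 := derive2_sumr oU sf (e i) (index_enum 'I_n) (fun j => Y 0 j *: e j) Ua.
  rewrite -row_sum_delta in E1; apply: (etrans E1).
  by apply: eq_bigr => j _; exact: (derive2Zr oU sf).
have E2 := derive_dir_sum (index_enum 'I_n) xpredT (fun i => X 0 i *: e i) d.
rewrite -row_sum_delta in E2; apply: (etrans E2).
apply: eq_bigr => i _; apply: (etrans (derive_dirZ (X 0 i) (e i) d)).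
exact: (congr1 ( *:%R (X 0 i)) (E i)).
Qed.

Lemma second_form_expand X Y a : U a ->
  second_form f X Y a = \sum_i \sum_j (X 0 i * Y 0 j) *: second_form f (e i) (e j) a.
Proof.
move=> Ua; apply: (etrans (congr1 (normal_part f a) (derive2_expand X Y Ua))).
rewrite normal_part_sum; apply: eq_bigr => i _.
rewrite normal_part_sum scaler_sumr; apply: eq_bigr => j _.
exact: scalerA.
Qed.

Lemma second_form_suml (I : Type) (r : seq I) (c : I -> R) (F : I -> 'rV[R]_n) Z a :
  U a ->
  second_form f (\sum_(i <- r) c i *: F i) Z a = \sum_(i <- r) c i *: second_form f (F i) Z a.
Proof.
move=> Ua; have d : differentiable (fun b => 'D_Z f b) a.
  exact: (smooth_differentiable (smooth_derive Z sf) Ua).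
have E := derive_dir_sum r xpredT (fun i => c i *: F i) d.
apply: (etrans (congr1 (normal_part f a) E)); rewrite -normal_part_sum.
apply: (congr1 (normal_part f a)); apply: eq_bigr => i _; exact: derive_dirZ.
Qed.

Lemma flat_gauss a X Y Z W : U a -> flat_at f a ->
  lform (second_form f Y Z a) (second_form f X W a) =
  lform (second_form f X Z a) (second_form f Y W a).
Proof.
move=> Ua flat.
apply: (gauss_multilinear (b := fun i j => second_form f (e i) (e j) a)
  (B := fun X Y => second_form f X Y a)) => [X' Y'|i j k m].
  exact: second_form_expand.
exact: (flat_gauss_basis oU sf ug).
Qed.

Lemma shape_op_second_form a xi X Y : U a -> normal_field_near f a xi ->
  (X *m shape_op f xi a *m first_form f a *m Y^T) 0 0 =
  lform (second_form f X Y a) (xi a).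
Proof.
move=> Ua nxi; apply: (etrans (shape_opE sf X Y Ua (ug Ua) nxi)); apply/esym.
by apply: lform_second_form => //; have [_ /nbhs_singleton] := nxi.
Qed.

Lemma weingarten a xi X Y : U a -> normal_field_near f a xi ->
  lform ('D_Y f a) ('D_X xi a) = - lform (second_form f X Y a) (xi a).
Proof.
move=> Ua nxi; apply: (etrans (normal_field_weingarten sf X Y Ua nxi)).
congr (- _); apply/esym; apply: lform_second_form => //.
by have [_ /nbhs_singleton] := nxi.
Qed.

Lemma nondegenerate_second_form a w : U a -> pos_def_at f a -> (n <= N)%N ->
  nondegenerate_at f a -> normal_at f a w ->
  (forall X Y, lform (second_form f X Y a) w = 0) -> w = 0.
Proof.
move=> Ua pd nN nd nw h.
have [_ inj] := normal_fields_extend sf Ua pd nN nd.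
apply: inj => // X Y; apply: (etrans _ (h X Y)).
by apply/esym; exact: lform_second_form.
Qed.

(** Pairing with a normal u ignores the tangential part of any vector, so nondegeneracy of the
    ambient form descends to the normal space. *)
Lemma normal_nondegenerate a u : U a -> normal_at f a u ->
  (forall w, normal_at f a w -> lform u w = 0) -> u = 0.
Proof.
move=> Ua nu h; apply: lform_nondegenerate => y.
rewrite lformC -(lform_tangent_part sf y Ua nu) lformC.
apply: h; exact: normal_part_normal.
Qed.

End SecondForm.

(** * Principal directions and curvature normals at a point *)

Section PrincipalFrame.
Context {R : realType} {n N : nat}.
Variables (U : set 'rV[R]_n) (f : 'rV[R]_n -> 'rV[R]_N).
Variable v : 'I_n -> 'rV[R]_n -> 'rV[R]_N.
Hypothesis oU : open U.
Hypothesis sf : smooth_on U f.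
Hypothesis nN : (n <= N)%N.
Hypothesis flat : forall a, U a -> flat_at f a.
Hypothesis nondeg : forall a, U a -> nondegenerate_at f a.
Hypothesis curvatureP : forall a, U a -> forall w,
  curvature_normal f a w <-> exists i, w = v i a.
Hypothesis v_inj : forall a, U a -> injective (v ^~ a).
Local Notation G X Y a := (lform ('D_X f a) ('D_Y f a)).

Let ug a : U a -> first_form f a \in unitmx.
Proof. by move=> /flat[pd _]; exact: first_form_unit. Qed.

Lemma curvature_normal_normal a i : U a -> normal_at f a (v i a).
Proof. by move=> Ua; have [|] := (curvatureP Ua (v i a)).2; first by exists i. Qed.

Lemma tangent_pos a X : U a -> X != 0 -> 0 < G X X a.
Proof. by move=> Ua X0; rewrite -(first_form_lform sf) //; exact: (flat Ua).1. Qed.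

(** The third clause is the eigenvalue equation A_w X_i = (w, v_i) X_i for all normal w at once,
    stated through the second fundamental form and so free of normal fields. Lengths are left open;
    [unit_frame] fixes them. *)
Definition principal_frame (a : 'rV[R]_n) (X : 'I_n -> 'rV[R]_n) : Prop :=
  [/\ forall i, 0 < G (X i) (X i) a,
      forall i j, i != j -> G (X i) (X j) a = 0
    & forall i Y, second_form f (X i) Y a = G (X i) Y a *: v i a].

Lemma principal_frame_exists a : U a -> exists X, principal_frame a X.
Proof.
move=> Ua; have pd := (flat Ua).1.
have ex i : exists2 X, X != 0 & curvature_dist f a (v i a) X.
  by have [|] := (curvatureP Ua (v i a)).2; first by exists i.
have {ex} /choice[X XP] : forall i, exists X, X != 0 /\ curvature_dist f a (v i a) X.
  by move=> i; have [X X0 XE] := ex i; exists X.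
(* The difference of the two sides is normal, so it is tested against normal vectors; each of these
   extends to a normal field, to which the eigenvalue equation applies. *)
have sff i Y : second_form f (X i) Y a = G (X i) Y a *: v i a.
  apply/eqP; rewrite -subr_eq0; apply/eqP.
  have nv := curvature_normal_normal i Ua.
  have nII := second_form_normal sf ug (X i) Y Ua.
  apply: (normal_nondegenerate sf ug Ua) => [Z|w nw].
    by rewrite lformBr nII lformZr nv mulr0 subr0.
  have [ext _] := normal_fields_extend sf Ua pd nN (nondeg Ua).
  have [xi nxi <-] := ext w nw.
  rewrite lformBl -(shape_op_second_form sf ug (X i) Y Ua nxi).
  rewrite ((XP i).2 xi nxi) -!scalemxAl mxE (first_form_lform sf) // lformZl.
  by rewrite (lformC (v i a)) mulrC subrr.
exists X; split=> // [i|i j ij]; first by apply: tangent_pos => //; exact: (XP i).1.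
apply/eqP; apply: contraNT ij => Gij.
(* Symmetry of the second fundamental form gives (X_i, X_j) v_i = (X_i, X_j) v_j; distinct curvature
   normals therefore force orthogonality. *)
have := second_formC oU sf (X i) (X j) Ua; rewrite !sff (lformC ('D_(X j) f a)).
by move/(scalerI Gij)/(v_inj Ua)/eqP.
Qed.

Section AtPoint.
Variables (a : 'rV[R]_n) (X : 'I_n -> 'rV[R]_n).
Hypothesis Ua : U a.
Hypothesis frame : principal_frame a X.

Let Gp i : 0 < G (X i) (X i) a. Proof. by have [] := frame. Qed.
Let G0 i j : i != j -> G (X i) (X j) a = 0. Proof. by have [_ + _] := frame; exact. Qed.
Let IIE i Y : second_form f (X i) Y a = G (X i) Y a *: v i a.
Proof. by have [_ _ +] := frame; exact. Qed.
Let dfa : differentiable f a. Proof. exact: (smooth_differentiable sf Ua). Qed.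

(** Pairing with X_j reads off the j-th coefficient of a combination, so n orthogonal vectors of
    positive length are independent and form a basis. *)
Lemma frame_expand Y :
  Y = \sum_i (G Y (X i) a / G (X i) (X i) a) *: X i.
Proof.
pose M := \matrix_(i, j) X i 0 j.
have ME c : c *m M = \sum_i c 0 i *: X i.
  rewrite mulmx_sum_row; apply: eq_bigr => i _; congr (_ *: _).
  by apply/rowP => j; rewrite !mxE.
have Gc c j : G (c *m M) (X j) a = c 0 j * G (X j) (X j) a.
  rewrite ME derive_dir_sum // lform_suml (bigD1 j) //= big1 => [|i ij].
    by rewrite derive_dirZ // lformZl addr0.
  by rewrite derive_dirZ // lformZl G0 // mulr0.
have uM : M \in unitmx.
  rewrite -row_free_unit -kermx_eq0; apply/rowV0P => c /sub_kermxP cM.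
  apply/rowP => j; have := Gc c j; rewrite cM derive0 lform0l mxE => /esym/eqP.
  by rewrite mulf_eq0 (gt_eqF (Gp j)) orbF => /eqP.
rewrite -{1}(mulmxKV uM Y) ME; apply: eq_bigr => i _; congr (_ *: _).
by rewrite -{2}(mulmxKV uM Y) Gc mulfK // gt_eqF.
Qed.

(** The v_i span the values of the second fundamental form, so a normal w orthogonal to all of them
    has zero shape operator. *)
Lemma normal_eq0 w : normal_at f a w -> (forall i, lform (v i a) w = 0) -> w = 0.
Proof.
move=> nw h; apply: (nondegenerate_second_form sf Ua (flat Ua).1 nN (nondeg Ua) nw).
move=> Y Z; rewrite {1}(frame_expand Y) (second_form_suml sf) //.
rewrite lform_suml big1 // => i _.
apply: (etrans (lformZl _ _ _)).
rewrite (_ : lform _ w = 0) ?mulr0 //.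
apply: (etrans (congr1 (lform^~ w) (IIE i Z))).
exact: (etrans (lformZl _ _ _) (etrans (congr1 ( *%R _) (h i)) (mulr0 _))).
Qed.

Lemma curvature_normals_orthogonal i j : i != j -> lform (v i a) (v j a) = 0.
Proof.
move=> ij; have gauss := flat_gauss oU sf ug (X i) (X j) (X j) (X i) Ua (flat Ua).
have II0 : second_form f (X i) (X j) a = 0.
  exact: (etrans (IIE i (X j)) (etrans (congr1 ( *:%R^~ (v i a)) (G0 ij)) (scale0r _))).
have E1 := congr2 lform (IIE j (X j)) (IIE i (X i)).
have E2 := etrans gauss (etrans (congr1 (lform^~ _) II0) (lform0l _)).
have := etrans (esym E1) E2; rewrite lformZl lformZr [lform (v j a) _]lformC.
move: (lform (v i a) (v j a)) (lt0r_neq0 (Gp i)) (lt0r_neq0 (Gp j)) => c pi pj.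
by move/eqP; rewrite mulf_eq0 (negbTE pj) mulf_eq0 (negbTE pi) => /eqP.
Qed.

Hypothesis cone : forall b, U b -> lform (f b) (f b) = 0.

Lemma position_normal b : U b -> normal_at f b (f b).
Proof.
move=> Ub Y; have dfb := smooth_differentiable sf Ub.
have := derive_lform Y dfb dfb.
rewrite (near_eq_derive (g := fun=> 0)) ?derive_cst; last first.
  by apply: (open_eq_near oU _ Ub).
rewrite (lformC (f b)) -mulr2n -mulr_natl => /esym/eqP.
by rewrite mulf_eq0 pnatr_eq0 /= => /eqP.
Qed.

Lemma position_curvature_normal i : lform (v i a) (f a) = -1.
Proof.
have nf : normal_field_near f a f.
  split; first by exists U.
  have nU : \forall b \near a, U b by exact: open_nbhs_nbhs.
  by apply: filterS nU => b; exact: position_normal.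
have := weingarten sf (X i) (X i) Ua nf; rewrite (IIE i (X i)) lformZl.
move: (lform (v i a) (f a)) (lt0r_neq0 (Gp i)) => c p.
by rewrite -mulrN -[X in X = _]mulr1 => /(mulfI p) ->; rewrite opprK.
Qed.

Lemma curvature_normal_neq0 i : lform (v i a) (v i a) != 0.
Proof.
apply/eqP => vv.
have v0 : v i a = 0.
  apply: normal_eq0 => [|j]; first exact: curvature_normal_normal.
  by have [->//|ji] := eqVneq j i; exact: curvature_normals_orthogonal.
have := position_curvature_normal i; rewrite v0 lform0l => /eqP.
by rewrite eq_sym oppr_eq0 oner_eq0.
Qed.

Lemma normal_expand w : normal_at f a w ->
  w = \sum_j (lform w (v j a) / lform (v j a) (v j a)) *: v j a.
Proof.
move=> nw; apply/eqP; rewrite -subr_eq0; apply/eqP; apply: normal_eq0 => [Y|i].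
  rewrite lformBr nw lform_sumr big1 ?subr0 // => j _.
  by rewrite lformZr curvature_normal_normal // mulr0.
rewrite lformBr lform_sumr (bigD1 i) //= big1 => [|j ji].
  by rewrite lformZr divfK ?curvature_normal_neq0 // addr0 lformC subrr.
have ij : i != j by rewrite eq_sym.
by rewrite lformZr (curvature_normals_orthogonal ij) mulr0.
Qed.

Lemma position_formula : f a = - \sum_j (lform (v j a) (v j a))^-1 *: v j a.
Proof.
rewrite {1}(normal_expand (position_normal Ua)) -sumrN; apply: eq_bigr => j _.
by rewrite lformC position_curvature_normal mulN1r scaleNr.
Qed.

End AtPoint.
End PrincipalFrame.
Section SmoothOps.
Context {R : realType} {m n : nat}.
Implicit Types (U : set 'rV[R]_m) (f g : 'rV[R]_m -> 'rV[R]_n) (c : 'rV[R]_m -> R).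

Lemma smooth_scale U c f : open U -> (forall k, sCk k U c) -> smooth_on U f ->
  smooth_on U (fun a => c a *: f a).
Proof.
move=> oU sc /(smooth_coordP _ oU) sf; apply/(smooth_coordP _ oU) => k j.
by apply: sCk_eq (sCkM oU (sc k) (sf k j)) => // a _; rewrite mxE.
Qed.

Lemma smooth_sub U f g : open U -> smooth_on U f -> smooth_on U g ->
  smooth_on U (fun a => f a - g a).
Proof.
move=> oU /(smooth_coordP _ oU) sf /(smooth_coordP _ oU) sg.
apply/(smooth_coordP _ oU) => k j.
by apply: sCk_eq (sCkB oU (sf k j) (sg k j)) => // a _; rewrite !mxE.
Qed.

Lemma smooth_sum U p (F : 'I_p -> 'rV[R]_m -> 'rV[R]_n) : open U ->
  (forall i, smooth_on U (F i)) -> smooth_on U (fun a => \sum_i F i a).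
Proof.
move=> oU sF; apply/(smooth_coordP _ oU) => k j.
have h : sCk k U (fun a => \sum_i F i a 0 j).
  by apply: sCk_sum => // i _; have /(smooth_coordP _ oU) := sF i; exact.
by apply: sCk_eq h => // a _; rewrite summxE.
Qed.

Lemma smooth_sub_set U U' f : open U -> open U' -> U' `<=` U ->
  smooth_on U f -> smooth_on U' f.
Proof.
move=> oU oU' UU /(smooth_coordP _ oU) sf; apply/(smooth_coordP _ oU') => k j.
exact: sCk_sub UU (sf k j).
Qed.

End SmoothOps.

Lemma smooth_comp {R : realType} {m n p : nat} (U : set 'rV[R]_m) (V : set 'rV[R]_n)
    (g : 'rV[R]_n -> 'rV[R]_p) (f : 'rV[R]_m -> 'rV[R]_n) :
  open U -> open V -> (forall a, U a -> V (f a)) -> smooth_on V g -> smooth_on U f ->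
  smooth_on U (g \o f).
Proof.
move=> oU oV UV /(smooth_coordP _ oV) sg /(smooth_coordP _ oU) sf.
apply/(smooth_coordP _ oU) => k j.
exact: (sCk_comp (f := fun b => g b 0 j) oU UV).
Qed.

Section OrthogonalVectors.
Context {R : realType} {p N : nat}.
Variable w : 'I_p -> 'rV[R]_N.
Hypothesis orth : forall i j, i != j -> lform (w i) (w j) = 0.

Lemma lform_orthogonal_sum (c g : 'I_p -> R) j :
  lform (\sum_i c i *: (g i *: w i)) (w j) = c j * (g j * lform (w j) (w j)).
Proof.
rewrite lform_suml (bigD1 j) //= big1 => [|i ij].
  by rewrite !lformZl addr0.
by rewrite !lformZl (orth ij) !mulr0.
Qed.

Lemma lform_tangential (t d : 'rV[R]_N) (c : 'I_p -> R) :
  (forall k, lform t (w k) = 0) -> lform t (d - \sum_k c k *: w k) = lform t d.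
Proof.
move=> tw; rewrite lformBr lform_sumr big1 ?subr0 // => k _.
by rewrite lformZr tw mulr0.
Qed.

Hypothesis ww0 : forall k, lform (w k) (w k) != 0.

Lemma lform_projection (d : 'rV[R]_N) j :
  lform (w j) (d - \sum_k (lform d (w k) / lform (w k) (w k)) *: w k) = 0.
Proof.
rewrite lformBr lform_sumr (bigD1 j) //= big1 => [|i ij].
  by rewrite lformZr divfK // addr0 lformC subrr.
have ji : j != i by rewrite eq_sym.
by rewrite lformZr (orth ji) mulr0.
Qed.

End OrthogonalVectors.

(** * The principal frame and its dual coordinates *)

Section FrameField.
Context {R : realType} {n N : nat}.
Variables (U : set 'rV[R]_n) (f : 'rV[R]_n -> 'rV[R]_N).
Variable v : 'I_n -> 'rV[R]_n -> 'rV[R]_N.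
Hypothesis oU : open U.
Hypothesis sf : smooth_on U f.
Hypothesis sv : forall j, smooth_on U (v j).
Hypothesis nN : (n <= N)%N.
Hypothesis flat : forall a, U a -> flat_at f a.
Hypothesis nondeg : forall a, U a -> nondegenerate_at f a.
Hypothesis curvatureP : forall a, U a -> forall w,
  curvature_normal f a w <-> exists i, w = v i a.
Hypothesis v_inj : forall a, U a -> injective (v ^~ a).
Hypothesis cone : forall b, U b -> lform (f b) (f b) = 0.
Local Notation G X Y a := (lform ('D_X f a) ('D_Y f a)).
Local Notation vv j a := (lform (v j a) (v j a)).

Let ug a : U a -> first_form f a \in unitmx.
Proof. by move=> /flat[pd _]; exact: first_form_unit. Qed.

Let vv0 j a : U a -> vv j a != 0.
Proof.
move=> Ua; have [X fr] := principal_frame_exists oU sf nN flat nondeg curvatureP v_inj Ua.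
exact: (curvature_normal_neq0 oU sf nN flat nondeg curvatureP Ua fr cone).
Qed.

Lemma curvature_normal_field j a : U a -> normal_field_near f a (v j).
Proof.
move=> Ua; split; first by exists U.
have nU : \forall b \near a, U b by exact: open_nbhs_nbhs.
by apply: filterS nU => b Ub; exact: (curvature_normal_normal curvatureP).
Qed.

(** The tangential part of D_Y v_j, obtained by subtracting the components along the v_k. In this
    form its smoothness follows from that of the curvature normals, without any choice of
    eigenvectors. *)
Definition tangent_derivative j Y a : 'rV[R]_N :=
  'D_Y (v j) a - \sum_k (lform ('D_Y (v j) a) (v k a) / vv k a) *: v k a.

Lemma smooth_tangent_derivative j Y : smooth_on U (tangent_derivative j Y).
Proof.
have sD := smooth_derive Y (sv j).
apply: smooth_sub => //; apply: smooth_sum => // k; apply: smooth_scale => // q.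
apply: sCkM => //; first exact: (sCk_lform oU (sD q) (sv k q)).
by apply: sCkV => // [a Ua|]; [exact: vv0|exact: (sCk_lform oU (sv k q) (sv k q))].
Qed.

(** By Weingarten the tangential part is -A_{v_j} Y, and A_{v_j} has eigenvalue (v_k, v_j) on X_k,
    which is 0 unless k = j. The proof checks that the difference is normal and orthogonal to all
    v_k. *)
Lemma tangent_derivativeE j Y a X : U a -> principal_frame f v a X ->
  tangent_derivative j Y a =
  'D_(- (G Y (X j) a / G (X j) (X j) a * vv j a) *: X j) f a.
Proof.
move=> Ua fr; have dfa := smooth_differentiable sf Ua.
have [Gp G0 IIE] := fr.
have nv k := curvature_normal_normal curvatureP k Ua.
have orth i k := @curvature_normals_orthogonal _ _ _ _ _ _ oU sf flat _ _ Ua fr i k.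
apply/eqP; rewrite -subr_eq0; apply/eqP.
apply: (normal_eq0 sf nN flat nondeg Ua fr) => [Z|k]; last first.
  apply: (etrans (lformBr _ _ _)).
  have E1 : lform (v k a) (tangent_derivative j Y a) = 0.
    by apply: (lform_projection (w := v ^~ a)) => // i; exact: vv0.
  have E2 c : lform (v k a) ('D_(c *: X j) f a) = 0 by rewrite lformC; exact: nv.
  by rewrite E1 E2 subrr.
have E1 : lform (second_form f Y Z a) (v j a) =
    G Y (X j) a / G (X j) (X j) a * (G (X j) Z a * vv j a).
  apply: (etrans (congr1 (fun Y => lform (second_form f Y Z a) (v j a))
    (frame_expand sf Ua fr Y))).
  rewrite (second_form_suml sf) //.
  under eq_bigr do rewrite IIE.
  exact: (lform_orthogonal_sum (w := v ^~ a)).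
have E2 c : lform ('D_Z f a) ('D_(c *: X j) f a) = c * G (X j) Z a.
  apply: (etrans (congr1 (lform ('D_Z f a)) (derive_dirZ c (X j) dfa))).
  exact: (etrans (lformZr _ _ _) (congr1 ( *%R c) (lformC _ _))).
have E3 : lform ('D_Z f a) (tangent_derivative j Y a) = - lform (second_form f Y Z a) (v j a).
  apply: (etrans _ (weingarten sf Y Z Ua (curvature_normal_field j Ua))).
  by apply: (lform_tangential (w := v ^~ a)) => k; exact: nv.
apply: (etrans (lformBr _ _ _)).
apply: (etrans (congr2 (fun x y => x - y) (etrans E3 (congr1 -%R E1)) (E2 _))).
have alg (p q r : R) : - (p * (q * r)) - (- (p * r) * q) = 0 by ring.
exact: alg.
Qed.

Let vvE j k : sCk k U (fun a => vv j a).
Proof. exact: (sCk_lform oU (sv j k) (sv j k)). Qed.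

(** Only the ambient vectors [eps] will be differentiated; the coordinate vectors [E] are asked for
    one point at a time, with no regularity. *)
Definition unit_frame a (E : 'I_n -> 'rV[R]_n) (eps : 'I_n -> 'rV[R]_N) : Prop :=
  [/\ principal_frame f v a E, forall j, eps j = 'D_(E j) f a
    & forall j, lform (eps j) (eps j) = 1].

Lemma principal_frame_scale a X (c : 'I_n -> R) : U a -> principal_frame f v a X ->
  (forall i, c i != 0) -> principal_frame f v a (fun i => c i *: X i).
Proof.
move=> Ua [Gp G0 IIE] c0; have dfa := smooth_differentiable sf Ua.
have GE i j : G (c i *: X i) (c j *: X j) a = c i * c j * G (X i) (X j) a.
  have E := congr2 lform (derive_dirZ (c i) (X i) dfa) (derive_dirZ (c j) (X j) dfa).
  apply: (etrans E); apply: (etrans (lformZl _ _ _)).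
  exact: (etrans (congr1 ( *%R (c i)) (lformZr _ _ _)) (mulrA _ _ _)).
split=> [i|i j ij|i Y].
- by rewrite GE mulr_gt0 // -expr2 exprn_even_gt0 //= c0.
- by rewrite GE G0 // mulr0.
have E1 : second_form f (c i *: X i) Y a = c i *: second_form f (X i) Y a.
  have := second_form_suml sf [:: i] c X Y Ua; by rewrite !big_seq1.
have E2 : G (c i *: X i) Y a = c i * G (X i) Y a.
  exact: (etrans (congr1 (lform^~ ('D_Y f a)) (derive_dirZ (c i) (X i) dfa)) (lformZl _ _ _)).
by rewrite E1 E2 IIE scalerA.
Qed.

(** A principal frame [X0] is fixed at a0 and extended by constant coordinates. The tangential
    derivative of v_j along [X0 j] is a multiple of the j-th direction everywhere, and at a0 the
    factor is -(v_j, v_j), which is nonzero; near a0 it can be normalised. *)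
Lemma unit_frame_field a0 : U a0 -> exists (W : set 'rV[R]_n)
    (eps : 'I_n -> 'rV[R]_n -> 'rV[R]_N) (s : 'I_n -> R),
  [/\ open W /\ W a0, W `<=` U, forall j, smooth_on W (eps j),
      forall a, W a -> exists E, unit_frame a E (eps ^~ a)
    & forall j, s j * s j = 1 /\ forall a, W a -> 0 < s j * vv j a].
Proof.
move=> Ua0.
have [X0 fr0] := principal_frame_exists oU sf nN flat nondeg curvatureP v_inj Ua0.
have [Gp0 _ _] := fr0.
pose T j := tangent_derivative j (X0 j).
have sT j : smooth_on U (T j) by exact: smooth_tangent_derivative.
pose q j a := lform (T j a) (T j a).
have sq k j : sCk k U (q j) by exact: (sCk_lform oU (sT j k) (sT j k)).
(* The sign of (v_j, v_j) at a0. It persists on a small ball, which allows s to be a constant. *)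
pose s j : R := Num.sg (vv j a0).
have qT0 j a X c : U a -> T j a = 'D_(c *: X) f a -> q j a = c * c * G X X a.
  move=> Ua E; have E' := etrans E (derive_dirZ c X (smooth_differentiable sf Ua)).
  by rewrite /q E' lformZl lformZr mulrA.
have q0 j : 0 < q j a0.
  have E := tangent_derivativeE j (X0 j) Ua0 fr0.
  rewrite (qT0 _ _ _ _ Ua0 E) mulr_gt0 // -expr2 exprn_even_gt0 //=.
  by rewrite oppr_eq0 mulf_neq0 ?vv0 // divff // gt_eqF.
have s1 j : s j * s j = 1 by rewrite /s -expr2 sqr_sg vv0.
have sv0 j : 0 < s j * vv j a0 by rewrite /s -normrEsg normr_gt0 vv0.
have nU : \forall a \near a0, U a by exact: open_nbhs_nbhs.
have nq : \forall a \near a0, forall j, 0 < q j a.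
  have h j : \forall a \near a0, 0 < q j a.
    exact: (cvgr_gt _ (sCk_continuous (sq 0%N j) Ua0)).
  exact: filter_forall h.
have ns : \forall a \near a0, forall j, 0 < s j * vv j a.
  have h j : \forall a \near a0, 0 < s j * vv j a.
    have hs : sCk 0 U (fun a => s j * vv j a) by apply: sCkM => //; exact: sCk_cst.
    exact: (cvgr_gt _ (sCk_continuous hs Ua0)).
  exact: filter_forall h.
have /nbhs_ballP[r /= r0 hr] : \forall a \near a0, [/\ U a,
    forall j, 0 < q j a & forall j, 0 < s j * vv j a].
  by apply: filterS3 nU nq ns => a.
pose W := ball a0 r.
have oW : open W by exact: ball_open.
have WU : W `<=` U by move=> a /hr[].
have Wq j a : W a -> 0 < q j a by move=> /hr[].
exists W, (fun j a => (Num.sqrt (q j a))^-1 *: T j a), s.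
split=> //.
- by split => //; exact: ballxx.
- move=> j; apply: smooth_scale => // [k|]; last exact: smooth_sub_set (sT j).
  apply: sCkV => // [a Wa|]; first by rewrite gt_eqF // sqrtr_gt0 Wq.
  by apply: sCk_sqrt => // [a Wa|]; [exact: Wq|exact: sCk_sub WU (sq k j)].
- move=> a Wa; have Ua := WU a Wa; have dfa := smooth_differentiable sf Ua.
  have [X fr] := principal_frame_exists oU sf nN flat nondeg curvatureP v_inj Ua.
  pose c j := - (G (X0 j) (X j) a / G (X j) (X j) a * vv j a).
  have TE j : T j a = 'D_(c j *: X j) f a by exact: tangent_derivativeE.
  have sq0 j : Num.sqrt (q j a) != 0 by rewrite gt_eqF // sqrtr_gt0 Wq.
  pose d j := (Num.sqrt (q j a))^-1 * c j.
  exists (fun j => d j *: X j); split => [|j|j].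
  + apply: principal_frame_scale => // j; rewrite mulf_neq0 ?invr_eq0 //.
    apply/eqP => cj; have := Wq j a Wa.
    by rewrite (qT0 _ _ _ _ Ua (TE j)) cj !mul0r ltxx.
  + have E1 := congr1 ( *:%R (Num.sqrt (q j a))^-1) (TE j).
    apply: (etrans E1); apply/esym.
    have E2 := derive_dirZ (Num.sqrt (q j a))^-1 (c j *: X j) dfa.
    by rewrite -E2 scalerA.
  + rewrite lformZl lformZr -/(q j a) mulrA -invfM -expr2 sqr_sqrtr ?mulVf //.
    * by rewrite gt_eqF // Wq.
    * by rewrite ltW // Wq.
- by move=> j; split => // a /hr[].
Qed.

End FrameField.

(** * The weighted coframe is closed *)

Section ClosedForms.
Context {R : realType} {n N : nat}.
Variables (U W : set 'rV[R]_n) (f : 'rV[R]_n -> 'rV[R]_N).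
Variables (v eps : 'I_n -> 'rV[R]_n -> 'rV[R]_N) (s : 'I_n -> R).
Hypothesis oU : open U.
Hypothesis sf : smooth_on U f.
Hypothesis sv : forall j, smooth_on U (v j).
Hypothesis nN : (n <= N)%N.
Hypothesis flat : forall a, U a -> flat_at f a.
Hypothesis nondeg : forall a, U a -> nondegenerate_at f a.
Hypothesis curvatureP : forall a, U a -> forall w,
  curvature_normal f a w <-> exists i, w = v i a.
Hypothesis oW : open W.
Hypothesis WU : W `<=` U.
Hypothesis seps : forall j, smooth_on W (eps j).
Hypothesis frameW : forall a, W a -> exists E, unit_frame f v a E (eps ^~ a).
Hypothesis ss : forall j, s j * s j = 1.
Hypothesis sv0 : forall j a, W a -> 0 < s j * lform (v j a) (v j a).
Local Notation vv j a := (lform (v j a) (v j a)).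
Local Notation e := (@basis_vec R n).

(** Reciprocal of the classical Lame coefficient: the j-th coordinate vector of the final chart has
    length 1 / [lame j]. The factor s_j stands in for the absolute value and leaves a smooth
    function under the root. *)
Definition lame j a : R := Num.sqrt (s j * vv j a).

Definition coframe j k a : R := lame j a * lform (eps j a) ('D_(e k) f a).

Lemma lame_gt0 j a : W a -> 0 < lame j a.
Proof. by move=> Wa; rewrite sqrtr_gt0 sv0. Qed.

Lemma lame_sq j a : W a -> lame j a * lame j a = s j * vv j a.
Proof. by move=> Wa; rewrite -expr2 sqr_sqrtr // ltW // sv0. Qed.

Lemma lame_abs j a : W a -> `|vv j a| = lame j a * lame j a.
Proof.
move=> Wa; have p := sv0 j Wa; rewrite lame_sq //.
have s1 : `|s j| = 1.
  by apply/eqP; rewrite -(@eqrXn2 _ 2) // expr1n -normrX expr2 ss normr1.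
by rewrite -[LHS]mul1r -s1 -normrM gtr0_norm.
Qed.

Lemma vvE_lame j a : W a -> vv j a = s j * (lame j a * lame j a).
Proof. by move=> Wa; rewrite lame_sq // mulrA ss mul1r. Qed.

Let sl k j : sCk k W (lame j).
Proof.
apply: sCk_sqrt => // [a Wa|]; first exact: sv0.
apply: sCkM => //; first exact: sCk_cst.
exact: sCk_sub WU (sCk_lform oU (sv j k) (sv j k)).
Qed.

Lemma sCk_lame k j : sCk k W (lame j).
Proof. exact: sl. Qed.

Lemma sCk_coframe k j i : sCk k W (coframe j i).
Proof.
apply: sCkM => //; apply: (sCk_lform oW (seps j k)).
exact: (smooth_sub_set oU oW WU (smooth_derive (e i) sf)).
Qed.

Let u j a := (lame j a)^-1 *: v j a.

Let su j : smooth_on W (u j).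
Proof.
apply: smooth_scale => // [k|]; last exact: smooth_sub_set (sv j).
by apply: sCkV => // a Wa; rewrite gt_eqF // lame_gt0.
Qed.

Let uu j a : W a -> lform (u j a) (u j a) = s j.
Proof.
move=> Wa; have p := lame_gt0 j Wa; rewrite lformZl lformZr vvE_lame //.
by move: (lame j a) (s j) (lt0r_neq0 p) => l t l0; field.
Qed.

Let nv j a : U a -> normal_at f a (v j a).
Proof. exact: curvature_normal_normal. Qed.

Let nfv j a : W a -> normal_field_near f a (v j).
Proof. by move=> Wa; apply: (curvature_normal_field oU sv curvatureP); exact: WU. Qed.

Let nfu j a : W a -> normal_field_near f a (u j).
Proof.
move=> Wa; split; first by exists W.
have nW : \forall b \near a, W b by exact: open_nbhs_nbhs.
apply: filterS nW => b Wb X.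
exact: (etrans (lformZr _ _ _) (etrans (congr1 ( *%R _) (nv j (WU Wb) X)) (mulr0 _))).
Qed.

Let orth a : W a -> forall i j, i != j -> lform (v i a) (v j a) = 0.
Proof.
move=> Wa i j; have [E [fr _ _]] := frameW Wa.
exact: (curvature_normals_orthogonal oU sf flat (WU Wa) fr).
Qed.

Let vv0 j a : W a -> vv j a != 0.
Proof.
by move=> Wa; apply/eqP => h; have := sv0 j Wa; rewrite h mulr0 ltxx.
Qed.

Let dE j a : W a -> differentiable (eps j) a.
Proof. by move=> Wa; exact: (smooth_differentiable (seps j)). Qed.

Let dv j a : W a -> differentiable (v j) a.
Proof. by move=> /WU; exact: (smooth_differentiable (sv j)). Qed.

Let du j a : W a -> differentiable (u j) a.
Proof. by move=> Wa; exact: (smooth_differentiable (su j)). Qed.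

Lemma frame_weingarten xi j a X : W a -> normal_field_near f a xi ->
  lform (eps j a) ('D_X xi a) = - (lform (eps j a) ('D_X f a) * lform (v j a) (xi a)).
Proof.
move=> Wa nxi; have [E [[_ _ IIE] epsE _]] := frameW Wa.
have Ua := WU Wa.
apply: (etrans (congr1 (lform^~ ('D_X xi a)) (epsE j))).
apply: (etrans (weingarten sf X (E j) Ua nxi)); congr (- _).
apply: (etrans (congr1 (lform^~ (xi a)) (etrans (second_formC oU sf X (E j) Ua) (IIE j X)))).
by rewrite lformZl epsE.
Qed.

Lemma eps_derive_normal j k a X : W a ->
  lform ('D_X (eps j) a) (v k a) = lform (eps j a) ('D_X f a) * lform (v j a) (v k a).
Proof.
move=> Wa.
have E1 := derive_lform X (dE j Wa) (dv k Wa).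
have E2 : 'D_X (fun b => lform (eps j b) (v k b)) a = 0.
  rewrite (near_eq_derive (g := fun=> 0)) ?derive_cst //.
  apply: (open_eq_near oW _ Wa) => b Wb; have [E [_ epsE _]] := frameW Wb.
  by rewrite epsE; exact: nv (WU Wb) _.
have E3 := frame_weingarten j X Wa (nfv k Wa).
have := etrans (esym E1) E2 => /eqP; rewrite addr_eq0 => /eqP ->.
by rewrite E3 opprK.
Qed.

Lemma eps_derive_self j a X : W a -> lform ('D_X (eps j) a) (eps j a) = 0.
Proof.
move=> Wa; have E1 := derive_lform X (dE j Wa) (dE j Wa).
have E2 : 'D_X (fun b => lform (eps j b) (eps j b)) a = 0.
  rewrite (near_eq_derive (g := fun=> (1 : R))) ?derive_cst //.
  by apply: (open_eq_near oW _ Wa) => b Wb; have [E [_ _]] := frameW Wb; exact.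
have := etrans (esym E1) E2; rewrite (lformC (eps j a)).
by move/eqP; rewrite -mulr2n mulrn_eq0 /= => /eqP.
Qed.

Let u_derive_self j a X : W a -> lform ('D_X (u j) a) (u j a) = 0.
Proof.
move=> Wa; have E1 := derive_lform X (du j Wa) (du j Wa).
have E2 : 'D_X (fun b => lform (u j b) (u j b)) a = 0.
  rewrite (near_eq_derive (g := fun=> (s j : R))) ?derive_cst //.
  by apply: (open_eq_near oW _ Wa) => b Wb; exact: uu.
have := etrans (esym E1) E2; rewrite (lformC (u j a)).
by move/eqP; rewrite -mulr2n mulrn_eq0 /= => /eqP.
Qed.

(** The difference of the two sides is orthogonal to every eps_k, hence normal, and orthogonal to
    every v_k, hence zero by [normal_eq0]. *)
Lemma total_expand a p : W a ->
  p = \sum_k lform p (eps k a) *: eps k a +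
      \sum_k (lform p (v k a) / vv k a) *: v k a.
Proof.
move=> Wa; have Ua := WU Wa; have [E [fr epsE eps1]] := frameW Wa.
have [_ G0 _] := fr.
have dfa := smooth_differentiable sf Ua.
have eps0 i j : i != j -> lform (eps i a) (eps j a) = 0.
  by move=> ij; rewrite !epsE; exact: G0.
have epsv k j : lform (eps k a) (v j a) = 0 by rewrite epsE; exact: nv.
apply/eqP; rewrite -subr_eq0; apply/eqP.
apply: (normal_eq0 sf nN flat nondeg Ua fr) => [Y|j].
  have YE : 'D_Y f a = \sum_k lform ('D_Y f a) (eps k a) *: eps k a.
    have E1 := congr1 (fun Z => 'D_Z f a) (frame_expand sf Ua fr Y).
    apply: (etrans E1); apply: (etrans (derive_dir_sum _ _ _ dfa)).
    apply: eq_bigr => k _; apply: (etrans (derive_dirZ _ _ dfa)).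
    by rewrite -!epsE eps1 divr1.
  rewrite YE lform_suml big1 // => k _; rewrite lformZl.
  rewrite (_ : lform (eps k a) _ = 0) ?mulr0 //.
  rewrite lformBr lformDr !lform_sumr (bigD1 k) //= big1 => [|i ik]; last first.
    have ki : k != i by rewrite eq_sym.
    by rewrite lformZr (eps0 _ _ ki) mulr0.
  rewrite big1 => [|i _]; last by rewrite lformZr epsv mulr0.
  by rewrite lformZr eps1 mulr1 !addr0 lformC subrr.
rewrite opprD addrA lformBr lformBr lform_sumr big1 => [|k _]; last first.
  by rewrite lformZr [lform (v j a) _]lformC epsv mulr0.
rewrite subr0 -lformBr.
exact: (lform_projection (w := v ^~ a) (orth Wa) (vv0 ^~ a ^~ Wa)).
Qed.

Lemma normal_expand_at a w : W a -> normal_at f a w ->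
  w = \sum_k (lform w (v k a) / vv k a) *: v k a.
Proof.
move=> Wa nw; have [E [_ epsE _]] := frameW Wa.
rewrite {1}(total_expand w Wa) big1 ?add0r // => k _.
by rewrite lformC epsE nw scale0r.
Qed.

(** The vanishing factors: for k <> j, (D_Y u_j, eps_k) and (D_X eps_j, v_k) are multiples of (v_k,
    v_j) = 0; for k = j, (D_X eps_j, eps_j) = 0 and (D_Y u_j, v_j) = 0 because eps_j and u_j have
    constant square. *)
Lemma derive_cross j a X Y : W a -> lform ('D_Y (u j) a) ('D_X (eps j) a) = 0.
Proof.
move=> Wa.
have eu k : k != j -> lform ('D_Y (u j) a) (eps k a) = 0.
  move=> kj; rewrite lformC; apply: (etrans (frame_weingarten k Y Wa (nfu j Wa))).
  by rewrite /u lformZr (orth Wa kj) !mulr0 oppr0.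
have pv k : k != j -> lform ('D_X (eps j) a) (v k a) = 0.
  move=> kj; apply: (etrans (eps_derive_normal j k X Wa)).
  have jk : j != k by rewrite eq_sym.
  by rewrite (orth Wa jk) mulr0.
have qv : lform ('D_Y (u j) a) (v j a) = 0.
  have := u_derive_self j Y Wa; rewrite /u lformZr => /eqP.
  by rewrite mulf_eq0 invr_eq0 gt_eqF ?lame_gt0 // => /eqP.
have pe := eps_derive_self j X Wa.
apply: (etrans (congr1 (lform ('D_Y (u j) a)) (total_expand ('D_X (eps j) a) Wa))).
move: ('D_X (eps j) a) ('D_Y (u j) a) pv pe eu qv => p q pv pe eu qv.
rewrite lformDr !lform_sumr !big1 ?addr0 // => k _; rewrite lformZr.
  by have [->|kj] := eqVneq k j; [rewrite qv mulr0|rewrite pv // mul0r mul0r].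
by have [->|kj] := eqVneq k j; [rewrite pe mul0r|rewrite eu // mulr0].
Qed.

Lemma coframeE j i a : W a -> coframe j i a = - s j * lform ('D_(e i) (u j) a) (eps j a).
Proof.
move=> Wa; have p := lame_gt0 j Wa.
have E := etrans (lformC _ _) (frame_weingarten j (e i) Wa (nfu j Wa)).
apply/esym; apply: (etrans (congr1 ( *%R (- s j)) E)).
rewrite /u lformZr vvE_lame // /coframe.
move: (lform _ _) (lame j a) (s j) (ss j) (lt0r_neq0 p) => t l c cc l0.
transitivity (c * c * (l * t)); first by field.
by rewrite cc mul1r.
Qed.

(** [coframeE] expresses theta_j through the first derivatives of u_j. Differentiating it, the term
    with D eps_j drops out by [derive_cross], and the second derivatives of u_j commute. *)
Lemma coframe_closed j i k a : W a ->
  'D_(e i) (coframe j k) a = 'D_(e k) (coframe j i) a.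
Proof.
have E i0 k0 b : W b -> 'D_(e i0) (coframe j k0) b =
   - s j * lform ('D_(e i0) (fun b => 'D_(e k0) (u j) b) b) (eps j b).
  move=> Wb.
  have dDu : differentiable (fun b => 'D_(e k0) (u j) b) b.
    exact: (smooth_differentiable (smooth_derive (e k0) (su j)) Wb).
  have E1 : 'D_(e i0) (coframe j k0) b =
    'D_(e i0) (fun b => - s j * lform ('D_(e k0) (u j) b) (eps j b)) b.
    apply: near_eq_derive; apply: (open_eq_near oW _ Wb) => c Wc.
    exact: coframeE.
  apply: (etrans E1).
  have h := is_derive_lform (e i0) dDu (dE j Wb).
  have E2 := @derive_val _ _ _ _ _ _ _ (is_deriveZ (- s j) h).
  apply: (etrans E2); apply: (congr1 ( *%R (- s j))).
  by apply: (etrans (congr1 (fun x => _ + x) (derive_cross j (e i0) (e k0) Wb))); rewrite addr0.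
move=> Wa; apply: (etrans (E i k a Wa)); apply: (etrans _ (esym (E k i a Wa))).
apply: (congr1 (fun w => - s j * lform w (eps j a))).
exact: (smooth_derive_swap (e i) (e k) oW (su j) Wa).
Qed.

End ClosedForms.
Lemma derive_comp_row {R : realType} {m n p : nat} (g : 'rV[R]_n -> 'rV[R]_p)
    (y : 'rV[R]_m -> 'rV[R]_n) z X : differentiable y z -> differentiable g (y z) ->
  'D_X (g \o y) z = 'D_('D_X y z) g (y z).
Proof.
move=> dy dg; have dc : differentiable (g \o y) z.
  exact: (@differentiable_comp _ _ _ _ y g).
by rewrite !deriveE // diff_comp.
Qed.

(** * Geometry in the coordinates dual to the coframe *)

Section CurvatureChart.
Context {R : realType} {n N : nat}.
Variables (U : set 'rV[R]_n) (f : 'rV[R]_n -> 'rV[R]_N).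
Variables (v : 'I_n -> 'rV[R]_n -> 'rV[R]_N).
Hypothesis oU : open U.
Hypothesis sf : smooth_on U f.
Hypothesis sv : forall j, smooth_on U (v j).
Hypothesis nN : (n <= N)%N.
Hypothesis flat : forall a, U a -> flat_at f a.
Hypothesis nondeg : forall a, U a -> nondegenerate_at f a.
Hypothesis curvatureP : forall a, U a -> forall w,
  curvature_normal f a w <-> exists i, w = v i a.
Local Notation vv j a := (lform (v j a) (v j a)).
Local Notation e := (@basis_vec R n).

Section Adapted.
Variables (W0 : set 'rV[R]_n) (eps : 'I_n -> 'rV[R]_n -> 'rV[R]_N) (s : 'I_n -> R).
Hypothesis oW0 : open W0.
Hypothesis W0U : W0 `<=` U.
Hypothesis seps : forall j, smooth_on W0 (eps j).
Hypothesis frameW : forall a, W0 a -> exists E, unit_frame f v a E (eps ^~ a).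
Hypothesis ss : forall j, s j * s j = 1.
Hypothesis sv0 : forall j a, W0 a -> 0 < s j * vv j a.
Local Notation lame := (lame v s).

Variables (W : set 'rV[R]_n) (x y : 'rV[R]_n -> 'rV[R]_n).
Hypothesis WW0 : W `<=` W0.
Local Notation V := (x @` W).
Hypothesis oV : open V.
Hypothesis yK : forall a, W a -> y (x a) = a.
Hypothesis sx : smooth_on W x.
Hypothesis sy : smooth_on V y.
Hypothesis Dx : forall a X j, W a -> 'D_X x a 0 j = lame j a * lform (eps j a) ('D_X f a).

Let Vy z : V z -> W (y z) /\ x (y z) = z.
Proof. by move=> [a Wa <-]; rewrite yK. Qed.

Let dy z : V z -> differentiable y z.
Proof. by move=> Vz; exact: (smooth_differentiable sy). Qed.

Let WU : W `<=` U. Proof. by move=> a /WW0/W0U. Qed.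

Let l0 j a : W a -> lame j a != 0.
Proof. by move=> Wa; rewrite gt_eqF // (lame_gt0 sv0) //; exact: WW0. Qed.

Let Dxy z X j : V z ->
  lame j (y z) * lform (eps j (y z)) ('D_('D_X y z) f (y z)) = X 0 j.
Proof.
move=> Vz; have [Wa xa] := Vy Vz.
apply: (etrans (esym (Dx ('D_X y z) j Wa))).
have E := derive_comp_row X (dy Vz) (smooth_differentiable sx Wa).
have E1 : 'D_X (x \o y) z = 'D_X id z.
  by apply: near_eq_derive; apply: (open_eq_near oV _ Vz) => b /Vy[].
have E2 := etrans (esym E) (etrans E1 (derive_id z X)).
exact: (congr1 (fun w : 'rV[R]_n => w 0 j) E2).
Qed.

Let DfyE z X : V z -> 'D_X (f \o y) z = 'D_('D_X y z) f (y z).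
Proof.
move=> Vz; have [Wa xa] := Vy Vz.
exact: (derive_comp_row X (dy Vz) (smooth_differentiable sf (WU Wa))).
Qed.

Let nv j a : U a -> normal_at f a (v j a).
Proof. exact: curvature_normal_normal. Qed.

(** Inverts dx_k = lame_k (eps_k, df): a tangent vector has no component along the v_k, and its
    eps_k component is read off from the derivative of x o y = id. *)
Lemma derive_chart z X : V z ->
  'D_X (f \o y) z = \sum_k (X 0 k / lame k (y z)) *: eps k (y z).
Proof.
move=> Vz; have [Wa xa] := Vy Vz.
have E := total_expand oU sf nN flat nondeg curvatureP W0U frameW sv0
  ('D_('D_X y z) f (y z)) (WW0 Wa).
apply: (etrans (DfyE X Vz)); apply: (etrans E).
rewrite [X in _ + X]big1 ?addr0 => [|k _]; last first.
  by rewrite nv ?mul0r ?scale0r //; exact: WU.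
apply: eq_bigr => k _; congr (_ *: _).
have h := Dxy X k Vz; rewrite -{}h lformC.
by move: (lform _ _) (lame k (y z)) (l0 k Wa) => t l ln; field.
Qed.

Let m k a : 'rV[R]_N := (lame k a)^-1 *: eps k a.

Lemma derive_chart_basis z k : V z -> 'D_(e k) (f \o y) z = m k (y z).
Proof.
move=> Vz; apply: (etrans (derive_chart (e k) Vz)).
rewrite (bigD1 k) //= big1 => [|i ik].
  by rewrite mxE !eqxx addr0 mul1r.
by rewrite mxE eqxx (negbTE ik) mul0r scale0r.
Qed.

Let eps_orth a : W a -> forall i j, lform (eps i a) (eps j a) = (i == j)%:R.
Proof.
move=> Wa i j; have [E [[_ G0 _] epsE eps1]] := frameW (WW0 Wa).
by have [->|ij] := eqVneq i j; [rewrite eps1|rewrite !epsE G0].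
Qed.

Lemma first_form_chart z : V z ->
  first_form (f \o y) z = diag_mx (\row_i `|vv i (y z)|^-1).
Proof.
move=> Vz; have [Wa xa] := Vy Vz; apply/matrixP => i j; rewrite mxE.
apply: (etrans (congr2 lform (derive_chart_basis i Vz) (derive_chart_basis j Vz))).
rewrite /m lformZl lformZr eps_orth // !mxE.
have [->|ij] := eqVneq i j; last by rewrite !mulr0.
rewrite (lame_abs ss sv0 j (WW0 Wa)) invfM ?eqxx mulr1n mulr1.
by [].
Qed.

Let sm k : smooth_on W0 (m k).
Proof.
apply: smooth_scale => // q; apply: sCkV => // [a Wa|].
  by rewrite gt_eqF // (lame_gt0 sv0).
exact: (sCk_lame oU sv oW0 W0U sv0).
Qed.

Let sfy : smooth_on V (f \o y).
Proof. by apply: (smooth_comp oV oU _ sf sy) => z /Vy[/WU]. Qed.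

(** The second fundamental form is diagonal in the new coordinates. The tangent field [m k] is
    differentiated only through (m_k, v_l) = 0, so no derivative of [lame] appears; the v_l then
    recover an arbitrary normal w. *)
Lemma derive2_chart z X k w : V z -> normal_at f (y z) w ->
  lform ('D_X (fun b => 'D_(e k) (f \o y) b) z) w =
  X 0 k * `|vv k (y z)|^-1 * lform (v k (y z)) w.
Proof.
move=> Vz nw; have [Wa xa] := Vy Vz; have Wa0 := WW0 Wa.
have E1 : 'D_X (fun b => 'D_(e k) (f \o y) b) z = 'D_('D_X y z) (m k) (y z).
  apply: (etrans _ (derive_comp_row X (dy Vz) (smooth_differentiable (sm k) Wa0))).
  apply: near_eq_derive; apply: (open_eq_near oV _ Vz) => b Vb.
  exact: derive_chart_basis.
apply: (etrans (congr1 (lform^~ w) E1)).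
set Z := 'D_X y z.
have mv l : lform ('D_Z (m k) (y z)) (v l (y z)) =
   (lame k (y z))^-1 * lform (eps k (y z)) ('D_Z f (y z)) * lform (v k (y z)) (v l (y z)).
  have dm := smooth_differentiable (sm k) Wa0.
  have dv := smooth_differentiable (sv l) (WU Wa).
  have F1 := derive_lform Z dm dv.
  have F2 : 'D_Z (fun b => lform (m k b) (v l b)) (y z) = 0.
    rewrite (near_eq_derive (g := fun=> (0 : R))) ?derive_cst //.
    apply: (open_eq_near oW0 _ Wa0) => b Wb; have [E [_ epsE _]] := frameW Wb.
    by rewrite lformZl epsE nv ?mulr0 //; exact: W0U.
  have F3 := frame_weingarten oU sf W0U frameW k Z Wa0
    (curvature_normal_field oU sv curvatureP l (WU Wa)).
  have := etrans (esym F1) F2 => /eqP; rewrite addr_eq0 => /eqP ->.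
  by rewrite /m lformZl F3 mulrN opprK mulrA.
have wE := normal_expand_at oU sf nN flat nondeg curvatureP W0U frameW sv0 Wa0 nw.
have h := Dxy X k Vz; rewrite -/Z in h.
rewrite {1}wE lform_sumr.
under eq_bigr do rewrite lformZr mv mulrCA.
rewrite -mulr_sumr.
have -> : \sum_l lform w (v l (y z)) / vv l (y z) * lform (v k (y z)) (v l (y z)) =
    lform (v k (y z)) w.
  rewrite [in RHS]wE lform_sumr; apply: eq_bigr => l _.
  by rewrite lformZr.
congr (_ * _); rewrite -h (lame_abs ss sv0 k Wa0).
by move: (lform _ _) (lame k (y z)) (l0 k Wa) => t l ln; field.
Qed.

Let vv_pos j a : W a -> `|vv j a| != 0.
Proof. by move=> Wa; rewrite (lame_abs ss sv0 j (WW0 Wa)) mulf_neq0 // l0. Qed.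

(** Reparametrisation does not change the tangent space: on both sides it is spanned by the eps_k at
    y z. *)
Lemma normal_chart z w : V z -> normal_at (f \o y) z w <-> normal_at f (y z) w.
Proof.
move=> Vz; have [Wa xa] := Vy Vz; split=> nw X; last first.
  exact: (etrans (congr1 (lform^~ w) (DfyE X Vz)) (nw _)).
have [E [fr epsE eps1]] := frameW (WW0 Wa).
have dfa := smooth_differentiable sf (WU Wa).
have ew k : lform (eps k (y z)) w = 0.
  have := etrans (congr1 (lform^~ w) (esym (derive_chart_basis k Vz))) (nw (e k)).
  by rewrite lformZl => /eqP; rewrite mulf_eq0 invr_eq0 (negbTE (l0 k Wa)) /= => /eqP.
have E1 := congr1 (fun Z => 'D_Z f (y z)) (frame_expand sf (WU Wa) fr X).
apply: (etrans (congr1 (lform^~ w) (etrans E1 (derive_dir_sum _ _ _ dfa)))).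
rewrite lform_suml big1 // => k _.
apply: (etrans (congr1 (lform^~ w) (derive_dirZ _ _ dfa))).
apply: (etrans (lformZl _ _ _)).
by apply: (etrans (congr1 (fun t => _ * lform t w) (esym (epsE k)))); rewrite ew mulr0.
Qed.

Lemma shape_op_chart (z : 'rV[R]_n) xi (X : 'rV[R]_n) k : V z ->
  normal_field_near (f \o y) z xi ->
  (X *m shape_op (f \o y) xi z) 0 k = X 0 k * lform (v k (y z)) (xi z).
Proof.
move=> Vz nxi; have [Wa xa] := Vy Vz.
have g1 : first_form (f \o y) z \in unitmx.
  rewrite first_form_chart // unitmxE det_diag unitfE; apply/prodf_neq0 => i _.
  by rewrite mxE invr_eq0 vv_pos.
have nw : normal_at f (y z) (xi z).
  have [_ nn] := nxi; exact: ((normal_chart _ Vz).1 (nbhs_singleton nn)).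
have E := etrans (shape_opE sfy X (e k) Vz g1 nxi) (derive2_chart X k Vz nw).
rewrite first_form_chart // mul_mx_diag in E.
have p : `|vv k (y z)|^-1 != 0 by rewrite invr_eq0 vv_pos.
move: (X *m shape_op (f \o y) xi z) E => T E.
rewrite /basis_vec trmx_delta -colE !mxE in E.
by apply: (mulIf p); rewrite E mulrAC.
Qed.

(** In this chart the shape operators are diagonal, with entries (v_k, xi). Testing an eigenvector X
    against the field v_i itself gives 0 = (v_i, v_i) X_k for k <> i, which kills every component
    but the i-th. *)
Lemma curvature_dist_chart (z : 'rV[R]_n) i : V z ->
  (forall j k, j != k -> lform (v j (y z)) (v k (y z)) = 0) ->
  curvature_dist (f \o y) z (v i (y z)) = [set t *: e i | t in [set: R]].
Proof.
move=> Vz orth; have [Wa xa] := Vy Vz; apply/seteqP; split => [X hX|_ [t _ <-] xi nxi].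
  have nvi : normal_field_near (f \o y) z (v i \o y).
    split.
      exists V; split => //; apply: (smooth_comp oV oU _ (sv i) sy) => b Vb.
      by have [/WU] := Vy Vb.
    have nV : \forall b \near z, V b by exact: open_nbhs_nbhs.
    apply: filterS nV => b Vb; have [/WU Ub _] := Vy Vb.
    exact: ((normal_chart _ Vb).2 (nv i Ub)).
  exists (X 0 i) => //; apply/rowP => k; rewrite !mxE eqxx /=.
  have [->|ki] := eqVneq k i; first by rewrite mulr1.
  have h := congr1 (fun w : 'rV[R]_n => w 0 k) (hX _ nvi).
  rewrite (shape_op_chart X k Vz nvi) mxE /= orth // mulr0 in h.
  rewrite mulr0; apply/eqP; rewrite eq_sym; apply/eqP.
  move/esym/eqP : h; rewrite mulf_eq0 => /orP[vi0|/eqP //].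
  by have := vv_pos i Wa; rewrite (eqP vi0) normr0 eqxx.
apply/rowP => k; rewrite (shape_op_chart _ k Vz nxi) !mxE eqxx /=.
have [->|ki] := eqVneq k i; first by rewrite lformC mulrC.
by rewrite !mulr0 mul0r.
Qed.

End Adapted.

Hypothesis v_inj : forall a, U a -> injective (v ^~ a).
Hypothesis cone : forall b, U b -> lform (f b) (f b) = 0.

Lemma curvature_chart_exists a0 : U a0 ->
  exists (W : set 'rV[R]_n) (x y : 'rV[R]_n -> 'rV[R]_n),
  [/\ [/\ open W, W a0 & W `<=` U], open (x @` W), forall a, W a -> y (x a) = a,
      smooth_on W x /\ smooth_on (x @` W) y
    & forall a, W a ->
       first_form (f \o y) (x a) = diag_mx (\row_i `|vv i a|^-1) /\
       forall i, curvature_dist (f \o y) (x a) (v i a) = [set t *: e i | t in [set: R]]].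
Proof.
move=> Ua0.
have [W0 [eps [s [[oW0 W0a0] W0U seps frameW ssv]]]] :=
  unit_frame_field oU sf sv nN flat nondeg curvatureP v_inj cone Ua0.
have ss j : s j * s j = 1 by have [] := ssv j.
have sv0 j a : W0 a -> 0 < s j * vv j a by have [_] := ssv j; exact.
have scf := sCk_coframe oU sf sv oW0 W0U seps sv0.
have clo := coframe_closed oU sf sv nN flat nondeg curvatureP oW0 W0U seps frameW ss sv0.
have [r [r0 rW0] [xs xsP]] := @closed_forms_exact R n n W0 a0
  (fun i k => coframe f v eps s i k) oW0 W0a0 (fun i j k => scf k i j)
  (fun i j k a Wa => clo i j k a Wa).
pose x a : 'rV[R]_n := \row_j xs j a.
have oB : open (ball a0 r) by exact: ball_open.
have Ba0 : ball a0 r a0 by exact: ballxx.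
have sx : smooth_on (ball a0 r) x.
  apply/(smooth_coordP _ oB) => k j.
  by apply: sCk_eq ((xsP j).1 k) => // a _; rewrite mxE.
have Dx a X j : ball a0 r a ->
    'D_X x a 0 j = lame v s j a * lform (eps j a) ('D_X f a).
  move=> Ba; have dxa := smooth_differentiable sx Ba.
  have dfa := smooth_differentiable sf (W0U _ (rW0 _ Ba)).
  apply: (etrans (derive_rowE X j dxa)).
  have E1 : (fun a => x a 0 j) = xs j by apply/funext => b; rewrite mxE.
  apply: (etrans (congr1 (fun h => 'D_X h a) E1)).
  apply: (etrans ((xsP j).2 a X Ba)).
  have E2 : lform (eps j a) ('D_X f a) = \sum_k X 0 k * lform (eps j a) ('D_(e k) f a).
    have E3 := congr1 (fun Z => 'D_Z f a) (row_sum_delta X).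
    apply: (etrans (congr1 (lform (eps j a)) (etrans E3 (derive_dir_sum _ _ _ dfa)))).
    rewrite lform_sumr; apply: eq_bigr => k _.
    exact: (etrans (congr1 (lform (eps j a)) (derive_dirZ _ _ dfa)) (lformZr _ _ _)).
  rewrite E2 mulr_sumr; apply: eq_bigr => k _; exact: mulrCA.
(* A vector annihilated by all dx_k is orthogonal to every eps_k, so its expansion in the principal
   frame vanishes. *)
have uJ : 'J x a0 \in unitmx.
  rewrite -row_free_unit -kermx_eq0; apply/rowV0P => X /sub_kermxP XJ.
  have [E [fr epsE _]] := frameW _ W0a0.
  rewrite (frame_expand sf Ua0 fr X) big1 // => k _.
  have h := Dx a0 X k Ba0.
  rewrite (deriveEjacobian X (smooth_differentiable sx Ba0)) XJ mxE in h.
  have l0 := lt0r_neq0 (lame_gt0 sv0 k W0a0).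
  move/esym/eqP : h; rewrite mulf_eq0 (negbTE l0) /= lformC epsE => /eqP ->.
  by rewrite mul0r scale0r.
have [W [y [[oW Wa0] WB oV yK [sy _]]]] := inverse_function oB Ba0 sx uJ.
have WW0 : W `<=` W0 by move=> a /WB/rW0.
have WU : W `<=` U by move=> a /WW0/W0U.
have sxW : smooth_on W x by exact: smooth_sub_set sx.
have DxW a X j : W a -> 'D_X x a 0 j = lame v s j a * lform (eps j a) ('D_X f a).
  by move=> /WB; exact: Dx.
exists W, x, y; split=> // a Wa; have Vxa : (x @` W) (x a) by exists a.
have yxa := yK a Wa; split => [|i].
  have := first_form_chart W0U frameW ss sv0 WW0
    oV yK sxW sy DxW Vxa.
  by rewrite yxa.
have [E [fr _ _]] := frameW _ (WW0 _ Wa).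
have orth j k : j != k -> lform (v j (y (x a))) (v k (y (x a))) = 0.
  rewrite yxa; exact: (curvature_normals_orthogonal oU sf flat (WU _ Wa) fr).
have := curvature_dist_chart oW0 W0U seps frameW ss sv0
  WW0 oV yK sxW sy DxW i Vxa orth.
by rewrite yxa.
Qed.
End CurvatureChart.

(** * Change of coordinates in a chart of the manifold *)

Section Charts.
Context {R : realType} {n : nat} {M : topologicalType}.

Lemma chart_invK (d : @chart R n M) q : chart_dom d q -> chart_inv d (chart_map d q) = q.
Proof. by move=> dq; apply: chart_mapK; exact: mem_set. Qed.

Lemma chart_image_openI (d : @chart R n M) (O : set M) :
  open O -> open (chart_map d @` (chart_dom d `&` O)).
Proof.
move=> oO; rewrite openE => _ [q [dq Oq] <-].
have Va : (chart_map d @` chart_dom d) (chart_map d q) by exists q.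
have n1 : \forall b \near chart_map d q, (chart_map d @` chart_dom d) b.
  by apply: open_nbhs_nbhs; split => //; exact: chart_image_open.
have n2 : \forall b \near chart_map d q, O (chart_inv d b).
  apply: (chart_inv_continuous Va); rewrite chart_invK //.
  by apply: open_nbhs_nbhs.
apply: filterS2 n1 n2 => b [q' dq' <-]; rewrite chart_invK // => Oq'.
by exists q'.
Qed.

Section Recoordinatize.
Variables (d : @chart R n M) (W : set 'rV[R]_n) (x y : 'rV[R]_n -> 'rV[R]_n).
Hypothesis oW : open W.
Hypothesis Wd : W `<=` chart_map d @` chart_dom d.
Hypothesis oV : open (x @` W).
Hypothesis yK : forall a, W a -> y (x a) = a.
Hypothesis sx : smooth_on W x.
Hypothesis sy : smooth_on (x @` W) y.

Let dom := chart_dom d `&` chart_map d @^-1` W.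

Let image_dom : (x \o chart_map d) @` dom = x @` W.
Proof.
apply/seteqP; split => [z [q [dq Wq] <-]|z [a Wa <-]].
  by exists (chart_map d q).
by have [q dq qa] := Wd Wa; exists q => //=; [split; rewrite /= ?qa|rewrite qa].
Qed.

Lemma recoordinatize : exists c : @chart R n M,
  [/\ chart_dom c = dom, chart_map c = x \o chart_map d & chart_inv c = chart_inv d \o y].
Proof.
have dom_open : open dom.
  rewrite openE => q [dq Wq]; apply: filterI.
    by apply: open_nbhs_nbhs; split => //; exact: chart_dom_open.
  by apply: (chart_map_continuous dq); exact: open_nbhs_nbhs.
have image_open : open ((x \o chart_map d) @` dom) by rewrite image_dom.
have mapK : {in dom, cancel (x \o chart_map d) (chart_inv d \o y)}.
  by move=> q /set_mem [dq Wq] /=; rewrite yK // chart_invK.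
have map_cont q : dom q -> {for q, continuous (x \o chart_map d)}.
  move=> [dq Wq]; apply: continuous_comp; first exact: chart_map_continuous.
  exact: (differentiable_continuous (smooth_differentiable sx Wq)).
have inv_cont a : ((x \o chart_map d) @` dom) a -> {for a, continuous (chart_inv d \o y)}.
  rewrite image_dom => Va; apply: continuous_comp.
    exact: (differentiable_continuous (smooth_differentiable sy Va)).
  by apply: chart_inv_continuous; case: Va => b Wb <-; rewrite yK //; exact: Wd.
by exists (Chart dom_open image_open mapK map_cont inv_cont).
Qed.

(** A transition of c is one of d composed with x or y and restricted to a smaller open set; this
    places the new chart in the maximal atlas. *)
Lemma recoordinatize_compatible (c b : @chart R n M) :
  chart_dom c = dom -> chart_map c = x \o chart_map d -> chart_inv c = chart_inv d \o y ->
  compatible d b -> compatible c b.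
Proof.
move=> cE mE iE [db bd].
have cd : chart_dom c `<=` chart_dom d by rewrite cE => q [].
split; rewrite /smooth_transition.
  rewrite iE; change (smooth_on (chart_map c @` (chart_dom c `&` chart_dom b))
    ((chart_map b \o chart_inv d) \o y)).
  have oS : open (chart_map c @` (chart_dom c `&` chart_dom b)).
    by apply: chart_image_openI; exact: chart_dom_open.
  have SV : chart_map c @` (chart_dom c `&` chart_dom b) `<=` x @` W.
    move=> z [q [cq bq] <-]; rewrite mE; move: cq; rewrite cE => -[dq Wq].
    by exists (chart_map d q).
  apply: (smooth_comp oS _ _ db (smooth_sub_set oV oS SV sy)).
    by apply: chart_image_openI; exact: chart_dom_open.
  move=> z [q [cq bq] <-]; rewrite mE; move: cq; rewrite cE => -[dq Wq].
  by exists q => //; rewrite /= yK.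
rewrite mE; change (smooth_on (chart_map b @` (chart_dom b `&` chart_dom c))
  (x \o (chart_map d \o chart_inv b))).
have oS : open (chart_map b @` (chart_dom b `&` chart_dom c)).
  by apply: chart_image_openI; exact: chart_dom_open.
have oS' : open (chart_map b @` (chart_dom b `&` chart_dom d)).
  by apply: chart_image_openI; exact: chart_dom_open.
have SS : chart_map b @` (chart_dom b `&` chart_dom c) `<=`
          chart_map b @` (chart_dom b `&` chart_dom d).
  by move=> z [q [bq cq] <-]; exists q => //; split => //; exact: cd.
apply: (smooth_comp oS oW _ sx (smooth_sub_set oS' oS SS bd)).
move=> z [q [bq cq] <-] /=; rewrite chart_invK //.
by move: cq; rewrite cE => -[].
Qed.

End Recoordinatize.
End Charts.

Theorem theorem2p7 (R : realType) (n : nat) (hn : (0 < n)%N)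
    (M : topologicalType) (S : @smooth_manifold R n M)
    (F : M -> 'rV[R]_(2 * n)) (v : 'I_n -> M -> 'rV[R]_(2 * n))
    (F_immersion : immersion S F)
    (F_light_cone : forall p, light_cone (F p))
    (F_flat : in_charts S F flat_at)
    (F_normal_flat : in_charts S F normal_flat_at)
    (F_nondegenerate : in_charts S F nondegenerate_at)
    (F_curvature_normals : curvature_normals S F v) :
  [/\ forall p j, lform (v j p) (v j p) != 0,
      forall p, F p = - \sum_j (lform (v j p) (v j p))^-1 *: v j p
    & forall p, exists c : @chart R n M,
        [/\ max_atlas S c, chart_dom c p, curvature_line_coords F v c
          & forall q, chart_dom c q ->
              first_form (F \o chart_inv c) (chart_map c q)
              = diag_mx (\row_i `|lform (v i q) (v i q)|^-1)]].
Proof.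
have [sF _] := F_immersion; have [sv vinj curvP] := F_curvature_normals.
have nN : (n <= 2 * n)%N by rewrite leq_pmull.
pose f (d : @chart R n M) := F \o chart_inv d.
pose vl (d : @chart R n M) i := v i \o chart_inv d.
pose U (d : @chart R n M) := chart_map d @` chart_dom d.
have oU d : open (U d) by exact: chart_image_open.
have flatU d : atlas S d -> forall a, U d a -> flat_at (f d) a.
  by move=> Sd a [q dq <-]; exact: F_flat.
have nondegU d : atlas S d -> forall a, U d a -> nondegenerate_at (f d) a.
  by move=> Sd a [q dq <-]; exact: F_nondegenerate.
have curvU d : atlas S d -> forall a, U d a -> forall w,
    curvature_normal (f d) a w <-> exists i, w = vl d i a.
  move=> Sd a [q dq <-] w; rewrite /vl /= chart_invK //; exact: curvP.
have injU d : forall a, U d a -> injective (vl d ^~ a) by move=> a _; exact: vinj.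
have coneU d : forall a, U d a -> lform (f d a) (f d a) = 0.
  by move=> a _; exact: F_light_cone.
(* Neither statement mentions coordinates, so any chart of the atlas around p can be used. *)
have pt p : (forall j, lform (v j p) (v j p) != 0) /\
    F p = - \sum_j (lform (v j p) (v j p))^-1 *: v j p.
  have [d Sd dp] := atlas_cover S p.
  have Ua : U d (chart_map d p) by exists p.
  have [X fr] := principal_frame_exists (oU d) (sF d Sd) nN (flatU d Sd) (nondegU d Sd)
    (curvU d Sd) (injU d) Ua.
  have pE : chart_inv d (chart_map d p) = p by exact: chart_invK.
  split => [j|].
    have := curvature_normal_neq0 (oU d) (sF d Sd) nN (flatU d Sd) (nondegU d Sd)
      (curvU d Sd) Ua fr (coneU d) j.
    by rewrite /vl /= pE.
  have := position_formula (oU d) (sF d Sd) nN (flatU d Sd) (nondegU d Sd)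
      (curvU d Sd) Ua fr (coneU d).
  by rewrite /f /vl /= pE.
split=> [p j|p|p]; [exact: (pt p).1|exact: (pt p).2|].
have [d Sd dp] := atlas_cover S p.
have Ua : U d (chart_map d p) by exists p.
have [W [x [y [[oW Wp WU] oV yK [sx sy] chartP]]]] := curvature_chart_exists (oU d)
  (sF d Sd) (fun j => sv j d Sd) nN (flatU d Sd) (nondegU d Sd) (curvU d Sd)
  (injU d) (coneU d) Ua.
have [c [cE mE iE]] := recoordinatize oW WU oV yK sx sy.
exists c; split.
- move=> b Sb; apply: (recoordinatize_compatible oW oV yK sx sy cE mE iE).
  exact: atlas_compatible Sd Sb.
- by rewrite cE.
- move=> q; rewrite cE mE iE => -[dq Wq] i.
  by have [_ /(_ i)] := chartP _ Wq; rewrite /vl /= chart_invK.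
- move=> q; rewrite cE mE iE => -[dq Wq].
  by have [+ _] := chartP _ Wq; rewrite /vl /= chart_invK.
Qed.
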